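(* Let $K\subseteq\mathbb{R}^2$ be a closed convex set with non-empty interior which is centrally symmetric and whose interior contains no point of $\mathbb{Z}^2$. Let $w:=w(K)$ be its lattice width and $A:=A(K)\in(0,\infty]$ its area. Then \begin{align*} 0&<w\le 2,\\ A&\le\infty &&\text{for } 0<w\le 1,\\ A&\le \frac{w^2}{2(w-1)} &&\text{for } 1<w\le 2,\\ A&\ge \tfrac12 w^2 &&\text{for } 0<w\le 2. \end{align*} Furthermore: (I) $w=2$ holds if and only if, up to a unimodular transformation, $K=\operatorname{conv}\{\pm(1,0),\pm(0,1)\}+(\frac12,\frac12)$. (II) Equality $A=\infty$ with $0<w\le1$ holds if and only if $K$ is unbounded and contained in a split. (III) For $1<w\le2$, equality $A=\frac{w^2}{2(w-1)}$ holds if and only if, up to a unimodular transformation, $K=\operatorname{conv}\{\pm(\frac w2,0),\pm(0,\frac{w}{2(w-1)})\}+(\frac12,\frac12)$. (IV) Equality $A=\frac12w^2$ holds if and only if, up to a unimodular transformation, $K$ is a translate of $\frac w2\operatorname{conv}\{\pm(1,\alpha),\pm(0,1)\}$ for some $0\le\alpha<1$ satisfying $\max\{1+\alpha,2-\alpha\}\ge w$.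
   Context: $K$ is centrally symmetric if $K=2c-K$ for some $c\in\mathbb{R}^2$. For $u\in\mathbb{R}^2$ the width function is $w(K,u):=\sup\{u^\top x:x\in K\}-\inf\{u^\top x:x\in K\}$ (possibly $+\infty$), and the lattice width is $w(K):=\min\{w(K,u):u\in\mathbb{Z}^2\setminus\{o\}\}$. A unimodular transformation is an affine bijection of $\mathbb{R}^2$ mapping $\mathbb{Z}^2$ onto $\mathbb{Z}^2$. A split is a set of the form $\{x\in\mathbb{R}^2: b\le a_1x_1+a_2x_2\le b+1\}$ with $a_1,a_2$ coprime integers and $b\in\mathbb{Z}$. *)

(* Defs.v *)
From HB Require Import structures.
From mathcomp Require Import all_boot all_order all_algebra.
From mathcomp Require Import all_classical all_reals all_analysis.
Set Implicit Arguments. Unset Strict Implicit. Unset Printing Implicit Defensive.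
Import Order.TTheory GRing.Theory Num.Theory.
Import numFieldNormedType.Exports.
Local Open Scope classical_set_scope.
Local Open Scope ring_scope.

Section Defs.
Variable R : realType.
Notation pt := (R * R)%type.

Definition is_int (x : R) : Prop := exists z : int, x = z%:~R.
Definition lattice_pt (p : pt) : Prop := is_int p.1 /\ is_int p.2.

Definition padd (p q : pt) : pt := (p.1 + q.1, p.2 + q.2).
Definition pscale (t : R) (p : pt) : pt := (t * p.1, t * p.2).
Definition dot (u x : pt) : R := u.1 * x.1 + u.2 * x.2.

Definition convex_set2 (K : set pt) : Prop :=
  forall x y, K x -> K y -> forall t : R, 0 <= t <= 1 ->
    K (padd (pscale t x) (pscale (1 - t) y)).

Definition centrally_symmetric (K : set pt) : Prop :=
  exists c : pt, K = [set padd (pscale 2 c) (pscale (-1) x) | x in K].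

Definition width_fun (K : set pt) (u : pt) : \bar R :=
  (ereal_sup [set (dot u x)%:E | x in K] - ereal_inf [set (dot u x)%:E | x in K])%E.

Definition lattice_width (K : set pt) : \bar R :=
  ereal_inf [set width_fun K u | u in [set u | lattice_pt u /\ u != (0, 0)]].

Definition area (K : set pt) : \bar R :=
  ((@lebesgue_measure R) \x (@lebesgue_measure R))%E K.

Definition unimodular (T : pt -> pt) : Prop :=
  (exists a b c d e f : R, forall x : pt,
      T x = (a * x.1 + b * x.2 + e, c * x.1 + d * x.2 + f)) /\
  bijective T /\
  (forall p : pt, lattice_pt p <-> lattice_pt (T p)).

Definition conv_hull (s : seq pt) : set pt :=
  [set x | exists l : seq R, [/\ size l = size s, all (fun t => 0 <= t) l,
     \sum_(i < size s) nth 0 l i = 1 &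
     x = (\sum_(i < size s) nth 0 l i * (nth (0,0) s i).1,
          \sum_(i < size s) nth 0 l i * (nth (0,0) s i).2)]].

Definition split_set (a1 a2 b : int) : set pt :=
  [set x | b%:~R <= a1%:~R * x.1 + a2%:~R * x.2 <= b%:~R + 1].
Definition is_split (S : set pt) : Prop :=
  exists a1 a2 b : int, coprimez a1 a2 /\ S = split_set a1 a2 b.

Definition bounded2 (K : set pt) : Prop :=
  exists M : R, forall x, K x -> `|x.1| <= M /\ `|x.2| <= M.

Definition translate2 (v : pt) (S : set pt) : set pt := [set padd v x | x in S].
Definition dilate2 (t : R) (S : set pt) : set pt := [set pscale t x | x in S].

End Defs.

(* Main.v *)
Require Import Defs.
From HB Require Import structures.
From mathcomp Require Import all_boot all_order all_algebra.
From mathcomp Require Import all_classical all_reals all_analysis.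
From mathcomp Require Import measurable_realfun ring lra zify.
Set Implicit Arguments. Unset Strict Implicit. Unset Printing Implicit Defensive.
Import Order.TTheory GRing.Theory Num.Theory.
Import numFieldNormedType.Exports.
Local Open Scope classical_set_scope.
Local Open Scope ring_scope.

(* Centre the body at the origin: K = c + B with B = -B, and let w = 2m, where m is the
   least value of the support function of B at a nonzero lattice vector.  If B is
   unbounded it contains a line; by Dirichlet approximation lattice-freeness makes this line
   rational, and K lies in a split.
   Otherwise a unimodular map makes the first coordinate the minimal direction, with
   (m, s) in B and 0 <= s < m.

   Lower bound: the widths in the directions e2 and e2 - e1 give points q and r of B, and
   the hexagon spanned by (m, s), q, r has area at least 2 m^2; equality forces a
   parallelogram.

   Upper bound: the length l(x) of the vertical chord of B at x is even and concave on
   [-m, m], and l(1/2) <= 1 since some lattice column lies at |x| <= 1/2.  A concave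
   function through (1/2, 1) that is nonnegative at m lies below a line through (1/2, 1),
   and integrating the steepest such line gives 2 m^2 / (2 m - 1).  For m > 1 this
   contradicts the lower bound. *)

(** * Area under affine maps *)

(** Shearing to [0 <= s < m] makes e2 and e2 - e1 the useful directions: for [0 < s] the points (m,
    s) and -(m, s) reach [m] in neither, so B must contain further points. The slope in the upper
    bound is limited because the chord length at [m] is nonnegative: a line through (1/2, 1) can
    fall at rate at most 1/(m - 1/2). After integration the rate [k] enters through the term k m (1
    - m). This increases with [k] for m < 1, which gives the upper bound and pins down [k] in the
    equality case; it decreases for m > 1, which gives the contradiction; it vanishes at m = 1,
    where the estimate says nothing about the shape. At m = 1, however, the two area bounds
    coincide, and the equality case of the lower bound takes over. The condition max(1 + alpha, 2 -
    alpha) >= w expresses lattice-freeness: if it fails, then wherever the parallelogram is placed,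
    one of two lattice points in adjacent columns lies in its interior. *)

Section PlaneArea.
Context {R : realType}.
Local Notation mu := (@lebesgue_measure R).
Implicit Types (K : set (R * R)).

Lemma open_measurable2 (U : set (R * R)) : open U -> measurable U.
Proof.
move=> oU.
(* Measurability in the plane refers to the product sigma-algebra, so an open set is exhibited as a
   union of rectangles; rational endpoints make the union countable. *)
pose box (q : rat * rat * (rat * rat)) : set (R * R) :=
  (`]ratr q.1.1, ratr q.1.2[%classic `*` `]ratr q.2.1, ratr q.2.2[%classic).
pose F q := if pselect (box q `<=` U) then box q else set0.
have -> : U = \bigcup_q F q.
  apply/seteqP; split => [[x y] Uxy|p [q _]]; last first.
    by rewrite /F; case: pselect => // bU; exact: bU.
  have /nbhs_ballP[e /= e0 beU] : nbhs (x, y) U by exact: open_nbhs_nbhs.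
  have near_rat (z : R) : exists q : rat * rat,
      [/\ z - e < ratr q.1, ratr q.1 < z, z < ratr q.2 & ratr q.2 < z + e].
    have [q1] : exists q1 : rat, ratr q1 \in `]z - e, z[.
      by apply: rat_in_itvoo; rewrite ltrBlDr ltrDl.
    have [q2] : exists q2 : rat, ratr q2 \in `]z, z + e[.
      by apply: rat_in_itvoo; rewrite ltrDl.
    rewrite !in_itv/= => /andP[? ?] /andP[? ?].
    by exists (q1, q2).
  have [qx [x1 x2 x3 x4]] := near_rat x.
  have [qy [y1 y2 y3 y4]] := near_rat y.
  exists (qx, qy) => //; rewrite /F; case: pselect => [?|].
    by split; rewrite /= in_itv/= ?x2 ?x3 ?y2 ?y3.
  move=> nb; exfalso; apply: nb => -[u v] []; rewrite /= !in_itv/=; move=> /andP[u1 u2]; move=> /andP[v1 v2].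
  by apply: beU; split; rewrite /ball/= ltr_distl; lra.
apply: countable_bigcupT_measurable; first exact: countableP.
move=> q; rewrite /F; case: pselect => ? /=; last exact: measurable0.
by apply: measurableX; exact: measurable_itv.
Qed.

Lemma closed_measurable2 K : closed K -> measurable K.
Proof.
move=> cK; rewrite -(setCK K); apply: measurableC.
by apply: open_measurable2; exact: closed_openC.
Qed.

(** The push-forward of Lebesgue measure under a translation agrees with it on half-open intervals,
    and these determine the measure. *)
Lemma lebesgue_measure_shift (t : R) (A : set R) : measurable A ->
  mu [set y | A (y + t)] = mu A.
Proof.
move=> mA.
have mf : measurable_fun [set: measurableTypeR R]
    ((fun y => y + t) : measurableTypeR R -> measurableTypeR R).
  by apply: continuous_measurable_fun => x; apply: cvgD; [exact: cvg_id|exact: cvg_cst].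
pose nu := pushforward mu ((fun y => y + t) : _ -> measurableTypeR R).
have -> : mu [set y | A (y + t)] = nu A by [].
apply/esym/lebesgue_measure_unique => // _ [[a b]] _ <-.
rewrite /= /pushforward.
have -> : (fun y : R => y + t) @^-1` `]a, b]%classic = `]a - t, b - t]%classic.
  by apply/seteqP; split => y /=; rewrite !in_itv/=; lra.
rewrite !lebesgue_measure_itv/= !lte_fin ltrD2r.
by case: ifP => // _; rewrite -!EFinB; congr EFin; ring.
Qed.

(** Sets are mostly moved by preimage under this map, because closedness and convexity then pass
    over without an inverse. *)
Definition affine2 (a b c d e f : R) (x : R * R) : R * R :=
  (a * x.1 + b * x.2 + e, c * x.1 + d * x.2 + f).

Lemma continuous_linear2 (u v w : R) :
  continuous (fun x : R * R => u * x.1 + v * x.2 + w).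
Proof.
move=> x; apply: cvgD; last exact: cvg_cst.
apply: cvgD; apply: cvgM; try exact: cvg_cst; [exact: cvg_fst|exact: cvg_snd].
Qed.

Lemma continuous_affine2 a b c d e f : continuous (affine2 a b c d e f).
Proof.
move=> x.
have A u v w := @continuous_linear2 u v w x.
exact: (cvg_pair (A a b e) (A c d f)).
Qed.

Lemma closed_affine2 a b c d e f K :
  closed K -> closed (affine2 a b c d e f @^-1` K).
Proof.
by move=> cK; apply: closed_comp => // x _; exact: continuous_affine2.
Qed.

(** The shear only translates each vertical slice. *)
Lemma area_shear (k t : R) K : closed K ->
  area (affine2 1 0 k 1 0 t @^-1` K) = area K.
Proof.
move=> cK; rewrite /area /product_measure1; apply: eq_integral => x _ /=.
rewrite -[RHS](lebesgue_measure_shift (k * x + t)); last first.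
  by apply: measurable_xsection; exact: closed_measurable2.
congr mu; apply/seteqP; split => y /=; rewrite !/xsection /= !inE /affine2/=.
  by rewrite mul1r mul0r !addr0 mul1r (addrC _ y) addrA.
by rewrite mul1r mul0r !addr0 mul1r (addrC (k * x) y) addrA.
Qed.

(** Both iterated integrals give the product measure, by its uniqueness. *)
Lemma area_swap K : closed K -> area (affine2 0 1 1 0 0 0 @^-1` K) = area K.
Proof.
move=> cK; have mK := closed_measurable2 cK.
rewrite /area.
rewrite [RHS](@product_measure_unique _ _ _ _ _ mu mu (mu \x^ mu)%E) //; last first.
  by move=> A B mA mB; exact: product_measure2E.
rewrite /= /product_measure1 /product_measure2; apply: eq_integral => x _ /=.
congr mu; apply/seteqP; split => y /=; rewrite /xsection /ysection /= !inE /affine2/=;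
 by rewrite !mul1r !mul0r !addr0 !add0r.
Qed.

Lemma affine2_comp a b c d e f a' b' c' d' e' f' K :
  affine2 a b c d e f @^-1` (affine2 a' b' c' d' e' f' @^-1` K) =
  affine2 (a' * a + b' * c) (a' * b + b' * d) (c' * a + d' * c)
    (c' * b + d' * d) (a' * e + b' * f + e') (c' * e + d' * f + f') @^-1` K.
Proof.
rewrite -comp_preimage; congr (_ @^-1` K); apply/funext => x.
by rewrite /affine2/=; congr (_, _); ring.
Qed.

Lemma area_hshear (k t : R) K : closed K ->
  area (affine2 1 k 0 1 t 0 @^-1` K) = area K.
Proof.
move=> cK; have cS : closed (affine2 0 1 1 0 0 0 @^-1` K) := closed_affine2 cK.
rewrite -[RHS](area_swap cK) -[RHS](area_shear k t cS) affine2_comp.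
rewrite -[RHS]area_swap; last exact: closed_affine2.
rewrite affine2_comp; congr (area (_ @^-1` K)).
by congr affine2; ring.
Qed.

(** With lower left entry [c != 0] the matrix factors into a horizontal, a vertical and a horizontal
    shear, with coefficients (a - 1)/c, c and (d - 1)/c. *)
Lemma area_SL2 (a b c d e f : R) K : closed K -> c != 0 -> a * d - b * c = 1 ->
  area (affine2 a b c d e f @^-1` K) = area K.
Proof.
move=> cK c0 D.
have -> : affine2 a b c d e f @^-1` K =
  affine2 1 ((d - 1) / c) 0 1 0 0 @^-1` (affine2 1 0 c 1 0 f @^-1`
   (affine2 1 ((a - 1) / c) 0 1 (e - (a - 1) / c * f) 0 @^-1` K)).
  rewrite !affine2_comp; congr (_ @^-1` K).
  congr affine2; try by (field).
  - have -> : b = (a * d - 1) / c by rewrite -D opprB addrC subrK mulfK.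
    by field.
rewrite area_hshear; last by do 2 apply: closed_affine2.
by rewrite area_shear ?area_hshear//; apply: closed_affine2.
Qed.

Lemma area_affine (a b c d e f : R) K : closed K -> (a * d - b * c) ^+ 2 = 1 ->
  area (affine2 a b c d e f @^-1` K) = area K.
Proof.
move=> cK.
have D1 (a' b' c' d' e' f' : R) K' : closed K' -> a' * d' - b' * c' = 1 ->
    area (affine2 a' b' c' d' e' f' @^-1` K') = area K'.
  move=> cK' D; have [c0|] := eqVneq c' 0; last by move=> ?; exact: area_SL2.
  have a0 : a' != 0 by apply: contra_eq_neq D => ->; rewrite c0; lra.
  (* Adding the first row to the second makes the lower left entry equal to [a'], which is nonzero;
     the shear with coefficient -1 undoes this. *)
  rewrite -[RHS](area_shear (- 1) 0 cK') -[RHS](@area_SL2 a' b' (c' + a') (d' + b') e' (f' + e') _).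
  - rewrite affine2_comp; congr (area (_ @^-1` K')).
    by congr affine2; ring.
  - exact: closed_affine2.
  - by rewrite c0 add0r.
  - by rewrite -D; ring.
move=> /eqP; rewrite sqrf_eq1 => /orP[] /eqP D; first exact: D1.
rewrite -[RHS]area_swap// -[RHS](D1 c d a b f e).
- rewrite affine2_comp; congr (area (_ @^-1` K)).
  by congr affine2; ring.
- exact: closed_affine2.
- by rewrite -[RHS]opprK -D; ring.
Qed.

End PlaneArea.

(** * Integration over vertical slices *)

Section Slices.
Context {R : realType}.
Local Notation mu := (@lebesgue_measure R).
Implicit Types (K : set (R * R)) (a b c : R).

Definition slice_area K a b : \bar R :=
  (\int[mu]_(x in `[a, b]) mu (xsection K x))%E.

Lemma measurable_slice K (D : set R) : measurable K ->
  measurable_fun D (fun x => mu (xsection K x)).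
Proof.
move=> mK; apply: measurable_funTS.
by have := measurable_fun_xsection mu mK.
Qed.

Lemma slice_area_split K a b c : measurable K -> a <= b -> b <= c ->
  slice_area K a c = (slice_area K a b + slice_area K b c)%E.
Proof.
move=> mK ab bc; rewrite /slice_area.
have -> : `[a, c]%classic = (`[a, b] `|` `]b, c])%classic.
  apply/seteqP; split => x /=; rewrite !in_itv/=.
    by move=> /andP[ax xc]; case: (leP x b) => xb; [left|right]; rewrite ?ax.
  by move=> [/andP[ax xb]|/andP[bx xc]]; apply/andP; split; lra.
rewrite ge0_integral_setU//.
- by rewrite (@integral_itv_obnd_cbnd _ b)//; exact: measurable_slice.
- exact: measurable_slice.
- rewrite disj_set2E; apply/eqP/seteqP; split => // x [] /=.
  by rewrite !in_itv/= => /andP[_ xb] /andP[bx _]; lra.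
Qed.

Lemma slice_area_le K a b : measurable K -> (slice_area K a b <= area K)%E.
Proof.
move=> mK; apply: ge0_subset_integral => //; exact: measurable_slice.
Qed.

Lemma area_slice K a b : measurable K -> (forall x, K x -> a <= x.1 <= b) ->
  area K = slice_area K a b.
Proof.
move=> mK Kab; rewrite /slice_area integral_mkcond; apply: eq_integral => x _ /=.
rewrite patchE; case: ifPn => // xab.
rewrite (_ : xsection K x = set0) ?measure0//; apply/seteqP; split => // y.
rewrite /xsection/= inE => /Kab /= xab'; move/negP: xab; apply.
by rewrite inE/= in_itv/=.
Qed.

Lemma integral_linear (al be a b : R) : a <= b ->
  (\int[mu]_(x in `[a, b]) (al + be * x)%:E = ((b - a) * (al + be * (a + b) / 2))%:E)%E.
Proof.
rewrite le_eqVlt => /predU1P[<-|ab].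
  by rewrite set_itv1 integral_set1 subrr mul0r.
pose F (x : R) := al * x + be / 2 * x ^+ 2.
have dF (x : R) : is_derive x 1 F (al + be * x).
  by apply: is_derive_eq; rewrite /GRing.scale/=; field.
have cf : continuous (fun x : R => al + be * x).
  by move=> x; apply: cvgD; [exact: cvg_cst|apply: cvgM; [exact: cvg_cst|exact: cvg_id]].
have cF : continuous F.
  by move=> x; apply: differentiable_continuous; apply/derivable1_diffP; case: (dF x).
rewrite (@continuous_FTC2 _ _ F)//.
- by rewrite -EFinB /F; congr EFin; field.
- exact: continuous_subspaceT.
- split; first by move=> x _; case: (dF x).
    exact/cvg_at_right_filter/cF.
  exact/cvg_at_left_filter/cF.
- by move=> x _; rewrite derive1E; apply: derive_val.
Qed.

Lemma slice_area_ge_linear K (al be a b : R) : measurable K -> a <= b ->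
  (forall x, a <= x <= b -> 0 <= al + be * x) ->
  (forall x, a <= x <= b -> ((al + be * x)%:E <= mu (xsection K x))%E) ->
  (((b - a) * (al + be * (a + b) / 2))%:E <= slice_area K a b)%E.
Proof.
move=> mK ab f0 fK; rewrite -integral_linear//; apply: ge0_le_integral => //.
- apply/measurable_EFinP; apply: measurable_funTS.
  apply: continuous_measurable_fun => x.
  by apply: cvgD; [exact: cvg_cst|apply: cvgM; [exact: cvg_cst|exact: cvg_id]].
- exact: measurable_slice.
Qed.

Lemma slice_area_le_linear K (al be a b : R) : measurable K -> a <= b ->
  (forall x, a <= x <= b -> (mu (xsection K x) <= (al + be * x)%:E)%E) ->
  (slice_area K a b <= ((b - a) * (al + be * (a + b) / 2))%:E)%E.
Proof.
move=> mK ab fK; rewrite -integral_linear//; apply: ge0_le_integral => //.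
- exact: measurable_slice.
- apply/measurable_EFinP; apply: measurable_funTS.
  apply: continuous_measurable_fun => x.
  by apply: cvgD; [exact: cvg_cst|apply: cvgM; [exact: cvg_cst|exact: cvg_id]].
Qed.

Lemma xsection_measure_ge K (x y y' : R) : measurable K ->
  (forall z, y <= z <= y' -> K (x, z)) ->
  ((y' - y)%:E <= mu (xsection K x))%E.
Proof.
move=> mK Kyy'.
have : (mu `[y, y']%classic <= mu (xsection K x))%E.
  apply: le_measure; rewrite ?inE//; first exact: measurable_xsection.
  by move=> z /=; rewrite /xsection/= in_itv/= inE; exact: Kyy'.
apply: le_trans; rewrite lebesgue_measure_itv/= lte_fin.
by case: ltP => yy'; rewrite -?EFinB lee_fin ?subr_le0.
Qed.

Lemma xsection_measure_le K (x y y' : R) : measurable K -> y <= y' ->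
  (forall z, K (x, z) -> y <= z <= y') ->
  (mu (xsection K x) <= (y' - y)%:E)%E.
Proof.
move=> mK yy' Kyy'.
have : (mu (xsection K x) <= mu `[y, y']%classic)%E.
  apply: le_measure; rewrite ?inE//; first exact: measurable_xsection.
  by move=> z /=; rewrite /xsection/= in_itv/= inE; exact: Kyy'.
move/le_trans; apply; rewrite lebesgue_measure_itv/= lte_fin.
by case: ifP => _; rewrite -?EFinB lee_fin// subr_ge0.
Qed.

Lemma convex_pt K (x y x' y' t : R) : convex_set2 K -> K (x, y) -> K (x', y') ->
  0 <= t <= 1 -> K (t * x + (1 - t) * x', t * y + (1 - t) * y').
Proof. by move=> cK Kxy Kxy' t01; have := cK _ _ Kxy Kxy' t t01. Qed.

Lemma convex_ptE K (x y x' y' t z1 z2 : R) : convex_set2 K -> K (x, y) -> K (x', y') ->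
  0 <= t <= 1 -> z1 = t * x + (1 - t) * x' -> z2 = t * y + (1 - t) * y' -> K (z1, z2).
Proof. by move=> cK Kxy Kxy' t01 -> ->; exact: convex_pt. Qed.

Lemma convex_vert K (x y y' z : R) : convex_set2 K -> K (x, y) -> K (x, y') ->
  y <= z <= y' -> K (x, z).
Proof.
move=> cK Ky Ky' /andP[yz zy'].
have [yy'|yy'] := ltP y y'; last by have -> : z = y by lra.
have y0 : 0 < y' - y by rewrite subr_gt0.
apply: (convex_ptE (t := (y' - z) / (y' - y)) cK Ky Ky').
- by apply/andP; split; [apply: divr_ge0; lra|rewrite ler_pdivrMr//; lra].
- by field; rewrite gt_eqF.
- by field; rewrite gt_eqF.
Qed.

(** By convexity K contains the trapezoid between its two vertical segments, so the slice lengths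
    dominate the linear interpolation of the side lengths. The case a = b is included because the
    hexagon below may have vertices on a common vertical line. *)
Lemma slice_area_trapezoid K (a b y1 y1' y2 y2' : R) : measurable K ->
  convex_set2 K -> a <= b -> y1 <= y1' -> y2 <= y2' ->
  K (a, y1) -> K (a, y1') -> K (b, y2) -> K (b, y2') ->
  (((b - a) * ((y1' - y1) + (y2' - y2)) / 2)%:E <= slice_area K a b)%E.
Proof.
move=> mK cK ab h1 h2 K1 K1' K2 K2'.
have [ab'|ba] := ltP a b; last first.
  have -> : b = a by lra.
  by rewrite subrr !mul0r; apply: integral_ge0 => x _; exact: measure_ge0.
have ba0 : 0 < b - a by rewrite subr_gt0.
have ban0 : b - a != 0 by rewrite gt_eqF.
pose be := ((y2' - y2) - (y1' - y1)) / (b - a).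
pose al := (y1' - y1) - be * a.
have E x : al + be * x = ((b - x) / (b - a)) * (y1' - y1) + (1 - (b - x) / (b - a)) * (y2' - y2).
  by rewrite /al /be; field.
have t01 x : a <= x <= b -> 0 <= (b - x) / (b - a) <= 1.
  move=> /andP[ax xb].
  by apply/andP; split; [apply: divr_ge0; lra|rewrite ler_pdivrMr//; lra].
have -> : (b - a) * ((y1' - y1) + (y2' - y2)) / 2 = (b - a) * (al + be * (a + b) / 2).
  by rewrite /al /be; field.
apply: slice_area_ge_linear => // x xab.
  have /andP[? ?] := t01 _ xab.
  by rewrite E addr_ge0// mulr_ge0// subr_ge0.
have /andP[t0 t1] := t01 _ xab.
move: E => /(_ x); set t := (b - x) / (b - a) in t0 t1 * => ->.
have -> : t * (y1' - y1) + (1 - t) * (y2' - y2) =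
  (t * y1' + (1 - t) * y2') - (t * y1 + (1 - t) * y2) by ring.
have xE : x = t * a + (1 - t) * b by rewrite /t; field.
apply: xsection_measure_ge => // z; apply: convex_vert => //.
  by apply: (convex_ptE (t := t) cK K1 K2); rewrite ?t0.
by apply: (convex_ptE (t := t) cK K1' K2'); rewrite ?t0.
Qed.

Definition det2 (p q : R * R) : R := p.1 * q.2 - p.2 * q.1.

Definition sym0 K := forall x y, K (x, y) -> K (- x, - y).

(** The vertical lines through the vertices cut the hexagon with vertices ±(0, n), ±q, ±r into four
    trapezoids, whose areas add up to the bound. *)
Lemma hexagon_vertical_ordered K (n q1 q2 r1 r2 : R) : closed K -> convex_set2 K -> sym0 K ->
  0 <= n -> 0 <= q1 -> q1 <= r1 -> 0 <= q1 * r2 - q2 * r1 ->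
  K (0, n) -> K (q1, q2) -> K (r1, r2) ->
  ((n * q1 + n * r1 + (q1 * r2 - q2 * r1))%:E <= area K)%E.
Proof.
move=> clK cK sK n0 q0 qr D Kn Kq Kr.
have mK := closed_measurable2 clK.
have [r0|r0] := ltP 0 r1; last first.
  have [-> ->] : q1 = 0 /\ r1 = 0 by split; lra.
  by rewrite !mulr0 !mul0r subr0 !addr0; exact: measure_ge0.
(* Height of the edge from (0, n) to r above the abscissa of q. *)
pose y := n + (r2 - n) * q1 / r1.
have r1n : r1 != 0 by rewrite gt_eqF.
have Ky : K (q1, y).
  apply: (convex_ptE (t := 1 - q1 / r1) cK Kn Kr).
  - by rewrite subr_ge0 ler_pdivrMr// mul1r qr/= gerBl divr_ge0// ltW.
  - by field.
  - by rewrite /y; field.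
have yq : q2 <= y.
  have : 0 <= r1 * (y - q2).
    have -> : r1 * (y - q2) = n * (r1 - q1) + (q1 * r2 - q2 * r1) by rewrite /y; field.
    by rewrite addr_ge0// mulr_ge0// subr_ge0.
  by rewrite pmulr_rge0// subr_ge0.
have Kn' : K (0, - n) by have := sK _ _ Kn; rewrite oppr0.
have nn : - n <= n by lra.
have T1 := slice_area_trapezoid mK cK q0 nn yq Kn' Kn Kq Ky.
have T2 := slice_area_trapezoid mK cK qr yq (lexx r2) Kq Ky Kr Kr.
have qN : - q1 <= 0 by lra.
have qrN : - r1 <= - q1 by lra.
have yqN : - y <= - q2 by lra.
have T3 := slice_area_trapezoid mK cK qN yqN nn (sK _ _ Ky) (sK _ _ Kq) Kn' Kn.
have T4 := slice_area_trapezoid mK cK qrN (lexx (- r2)) yqN (sK _ _ Kr) (sK _ _ Kr) (sK _ _ Ky) (sK _ _ Kq).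
apply: le_trans (slice_area_le (- r1) r1 mK).
rewrite (@slice_area_split _ (- r1) 0 r1)//; [|lra|lra].
rewrite (@slice_area_split _ (- r1) (- q1) 0)// (@slice_area_split _ 0 q1 r1)//.
apply: le_trans (leeD (leeD T4 T3) (leeD T1 T2)).
rewrite -!EFinD lee_fin le_eqVlt; apply/orP; left; apply/eqP.
by rewrite /y; field.
Qed.

Lemma hexagon_vertical K (n q1 q2 r1 r2 : R) : closed K -> convex_set2 K -> sym0 K ->
  0 <= n -> 0 <= q1 -> 0 <= r1 -> 0 <= q1 * r2 - q2 * r1 ->
  K (0, n) -> K (q1, q2) -> K (r1, r2) ->
  ((n * q1 + n * r1 + (q1 * r2 - q2 * r1))%:E <= area K)%E.
Proof.
move=> clK cK sK n0 q0 r0 D Kn Kq Kr.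
have [qr|rq] := leP q1 r1; first exact: hexagon_vertical_ordered.
(* Reflection in the horizontal axis reverses the orientation, so q and r exchange their roles. *)
pose K' := affine2 1 0 0 (-1) 0 0 @^-1` K.
have K'E x y : K' (x, y) = K (x, - y).
  by rewrite /K' /affine2/=; congr K; congr (_, _); ring.
have <- : area K' = area K by apply: area_affine => //; ring.
have -> : n * q1 + n * r1 + (q1 * r2 - q2 * r1) =
   n * r1 + n * q1 + (r1 * (- q2) - (- r2) * q1) by ring.
apply: hexagon_vertical_ordered => //; rewrite ?K'E ?opprK//; last 1 first.
- by have := sK _ _ Kn; rewrite oppr0.
- exact: closed_affine2.
- move=> [x y] [x' y'] Kx Ky t t01; rewrite /padd /pscale/= K'E.
  move: Kx Ky; rewrite !K'E => Kx Ky.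
  by apply: (convex_ptE (t := t) cK Kx Ky) => //; ring.
- by move=> x y; rewrite !K'E; exact: sK.
- exact: ltW.
- by move: D; congr (_ <= _); ring.
Qed.

Lemma convex_affine2 (a b c d e f : R) K : convex_set2 K ->
  convex_set2 (affine2 a b c d e f @^-1` K).
Proof.
move=> cK [x y] [x' y'] Kx Ky t t01.
by apply: (convex_ptE (t := t) cK Kx Ky) => //=; ring.
Qed.

Lemma sym0_affine2 (a b c d : R) K : sym0 K -> sym0 (affine2 a b c d 0 0 @^-1` K).
Proof.
move=> sK x y /sK; rewrite /affine2/=; congr K.
by congr (_, _); ring.
Qed.

Lemma hexagon_area K (p q r : R * R) : closed K -> convex_set2 K -> sym0 K ->
  p != 0 -> 0 <= det2 p q -> 0 <= det2 p r -> 0 <= det2 q r ->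
  K p -> K q -> K r ->
  ((det2 p q + det2 p r + det2 q r)%:E <= area K)%E.
Proof.
case: p q r => [p1 p2] [q1 q2] [r1 r2]; rewrite /det2/= => clK cK sK p0 dq dr dqr Kp Kq Kr.
have N0 : 0 < p1 ^+ 2 + p2 ^+ 2.
  rewrite lt_neqAle addr_ge0 ?sqr_ge0// andbT eq_sym paddr_eq0 ?sqr_ge0//.
  by rewrite !sqrf_eq0.
set N := p1 ^+ 2 + p2 ^+ 2 in N0.
have Nn : N != 0 by rewrite gt_eqF.
(* [G] has determinant 1 and sends (0, 1) to -p. A point z of K gets the first coordinate
   [det2 p z], so q and r land in the right half-plane and the vertical case applies with n = 1. *)
pose G := affine2 (- p2 / N) (- p1) (p1 / N) (- p2) 0 0.
have <- : area (G @^-1` K) = area K.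
  by apply: area_affine => //; rewrite -[RHS](expr1n _ 2); congr (_ ^+ 2); rewrite /N; field.
have GE x y : (G @^-1` K) (- p2 * x + p1 * y, - (p1 * x + p2 * y) / N) = K (x, y).
  rewrite /preimage/= /G /affine2/=; congr K; congr (_, _); rewrite /N; field => //.
have cG : convex_set2 (G @^-1` K) by exact: convex_affine2.
have sG : sym0 (G @^-1` K) by exact: sym0_affine2.
have clG : closed (G @^-1` K) by exact: closed_affine2.
have G1 : (G @^-1` K) (0, 1).
  have := sK _ _ Kp; rewrite -GE; congr (_ (_, _)); first by ring.
  by rewrite /N; field.
have := @hexagon_vertical _ 1 (- p2 * q1 + p1 * q2) (- (p1 * q1 + p2 * q2) / N)
  (- p2 * r1 + p1 * r2) (- (p1 * r1 + p2 * r2) / N) clG cG sG ler01.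
rewrite !GE => H.
have E : (- p2 * q1 + p1 * q2) * (- (p1 * r1 + p2 * r2) / N) -
 - (p1 * q1 + p2 * q2) / N * (- p2 * r1 + p1 * r2) = q1 * r2 - q2 * r1.
  by rewrite /N; field.
move: H; rewrite E => /(_ _ _ dqr G1 Kq Kr).
have -> : - p2 * q1 + p1 * q2 = p1 * q2 - p2 * q1 by ring.
have -> : - p2 * r1 + p1 * r2 = p1 * r2 - p2 * r1 by ring.
by rewrite !mul1r; exact.
Qed.

End Slices.

(** * Symmetric bodies and parallelograms *)

Section SymmetricBodies.
Context {R : realType}.
Local Notation mu := (@lebesgue_measure R).
Implicit Types (B K : set (R * R)) (p q : R * R).

(** Interior points described by closed squares, so that radii can be handled by plain arithmetic on
    the coordinates. *)
Definition int2 B (x y : R) := exists2 e : R, 0 < e &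
  forall u v, `|u| <= e -> `|v| <= e -> B (x + u, y + v).

Lemma interior_int2 B x y : interior B (x, y) <-> int2 B x y.
Proof.
split=> [/nbhs_ballP[e /= e0 eB]|[e e0 eB]].
  exists (e / 2); first by rewrite divr_gt0.
  move=> u v ue ve; apply: eB; split; rewrite /ball/=.
    by rewrite opprD addNKr normrN; lra.
  by rewrite opprD addNKr normrN; lra.
apply/nbhs_ballP; exists e => //= -[x' y'] [/=]; rewrite /ball/= => xe ye.
have -> : (x', y') = (x + (x' - x), y + (y' - y)) by congr (_, _); ring.
by apply: eB; rewrite distrC ltW.
Qed.

Lemma int2_sub B x y : int2 B x y -> B (x, y).
Proof.
by move=> [e e0 /(_ 0 0)]; rewrite normr0 !addr0 => /(_ (ltW e0) (ltW e0)).
Qed.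

(** The square around (x', y'), shrunk by the factor 1 - t towards (x, y), stays in B. *)
Lemma int2_segment B (x y x' y' t z1 z2 : R) : convex_set2 B -> B (x, y) -> int2 B x' y' ->
  0 <= t < 1 -> z1 = t * x + (1 - t) * x' -> z2 = t * y + (1 - t) * y' -> int2 B z1 z2.
Proof.
move=> cB Bxy [e e0 eB] /andP[t0 t1] -> ->.
have t10 : 0 < 1 - t by lra.
have t1n : 1 - t != 0 by rewrite gt_eqF.
exists ((1 - t) * e) => [|u v ue ve]; first exact: mulr_gt0.
have small s : `|s| <= (1 - t) * e -> `|s / (1 - t)| <= e.
  by rewrite normrM normfV (gtr0_norm t10) ler_pdivrMr// mulrC.
apply: (convex_ptE (t := t) cB Bxy (eB _ _ (small _ ue) (small _ ve))).
- by rewrite t0 ltW.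
- by field.
- by field.
Qed.

Definition sym_body B := [/\ closed B, convex_set2 B, sym0 B & int2 B 0 0].

Lemma sym_body0 B : sym_body B -> B (0, 0).
Proof. by move=> [_ _ _ /int2_sub]. Qed.

Lemma int2_scale B (t x y z1 z2 : R) : sym_body B -> `|t| < 1 -> B (x, y) ->
  z1 = t * x -> z2 = t * y -> int2 B z1 z2.
Proof.
move=> [_ cB sB B0] t1 Bxy -> ->; have [t0|t0] := leP 0 t.
  by apply: (int2_segment (t := t) cB Bxy B0); rewrite ?mulr0 ?addr0// t0 -(ger0_norm t0).
by apply: (int2_segment (t := - t) cB (sB _ _ Bxy) B0);
  rewrite ?mulr0 ?addr0 ?mulrNN// -(ltr0_norm t0) normr_ge0.
Qed.

(** The convex hull of ±p and ±q, written as a linear image of the l1 unit ball; this makes linear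
    images and the gauge |a| + |b| immediate. *)
Definition pgram p q : set (R * R) := [set x | exists a b : R, `|a| + `|b| <= 1 /\
  x = (a * p.1 + b * q.1, a * p.2 + b * q.2)].

(** The sign [s] is 1 or -1 even for a = 0, so multiplication by it always preserves a symmetric
    set. *)
Lemma norm_signed (a : R) : exists2 s, `|s| = 1 & s * `|a| = a.
Proof.
have [a0|a0] := leP 0 a; first by exists 1; rewrite ?normr1 // mul1r ger0_norm.
by exists (-1); rewrite ?normrN ?normr1 // ltr0_norm// mulrNN mul1r.
Qed.

Lemma sym0_signed B (s x y : R) : sym0 B -> `|s| = 1 -> B (x, y) -> B (s * x, s * y).
Proof.
move=> sB s1 Bxy; have [s0|s0] := leP 0 s.
  by move: s1; rewrite ger0_norm// => ->; rewrite !mul1r.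
by move: s1; rewrite ltr0_norm// => /eqP; rewrite eqr_oppLR => /eqP ->;
  rewrite !mulN1r; exact: sB.
Qed.

Lemma pgram_sub B p q : convex_set2 B -> sym0 B -> B p -> B q -> pgram p q `<=` B.
Proof.
case: p q => [p1 p2] [q1 q2] cB sB Bp Bq _ [a [b [ab ->]]] /=.
have B0 : B (0, 0).
  by apply: (convex_ptE (t := 1/2) cB Bp (sB _ _ Bp)); [lra|field|field].
have [sa sa1 saE] := norm_signed a.
have [sb sb1 sbE] := norm_signed b.
have Bp' := sym0_signed sB sa1 Bp.
have Bq' := sym0_signed sB sb1 Bq.
have [a0 b0] := (normr_ge0 a, normr_ge0 b).
(* The point is a combination of ±p with weight |a| and of a point on the segment from 0 to ±q; the
   latter is found by dividing by 1 - |a|, hence the separate case |a| = 1. *)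
have [A1|A1] := eqVneq `|a| 1.
  have b00 : b = 0 by apply/eqP; rewrite -normr_eq0; apply/eqP; lra.
  by move: Bp'; rewrite -[in X in _ -> X]saE A1 mulr1 b00 !mul0r !addr0.
have A2 : 0 < 1 - `|a| by have := lt_neqAle `|a| 1; rewrite A1 /=; lra.
have Bq2 : B (`|b| / (1 - `|a|) * (sb * q1), `|b| / (1 - `|a|) * (sb * q2)).
  apply: (convex_ptE (t := `|b| / (1 - `|a|)) cB Bq' B0); last 2 first.
  - by rewrite mulr0 addr0.
  - by rewrite mulr0 addr0.
  by rewrite divr_ge0 ?ler_pdivrMr//=; lra.
apply: (convex_ptE (t := `|a|) cB Bp' Bq2).
- by rewrite a0; lra.
- rewrite -[in LHS]saE -[in LHS]sbE; field; exact: lt0r_neq0.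
- rewrite -[in LHS]saE -[in LHS]sbE; field; exact: lt0r_neq0.
Qed.

Lemma pgram_coord p q (x y : R) : det2 p q != 0 -> exists a b,
  (x, y) = (a * p.1 + b * q.1, a * p.2 + b * q.2).
Proof.
case: p q => [p1 p2] [q1 q2]; rewrite /det2/= => D.
exists ((x * q2 - y * q1) / (p1 * q2 - p2 * q1)), ((p1 * y - p2 * x) / (p1 * q2 - p2 * q1)).
by congr (_, _); field.
Qed.

(* A point outside the parallelogram would span with p and q a hexagon of larger area. *)
Lemma pgram_of_area B p q : closed B -> convex_set2 B -> sym0 B -> B p -> B q ->
  0 < det2 p q -> area B = (2 * det2 p q)%:E -> B = pgram p q.
Proof.
move=> clB cB sB Bp Bq D AB; apply/seteqP; split; last exact: pgram_sub.
have p0 : p != 0.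
  by apply: contraTneq D => ->; rewrite /det2/= !mul0r subr0 ltxx.
have q0 : q != 0.
  by apply: contraTneq D => ->; rewrite /det2/= !mulr0 subr0 ltxx.
(* For b >= 0 the hexagon on p, (x, y), q has area (1 + a + b) [det2 p q], and for b < 0 the one on
   -q, (x, y), p has area (1 + a - b) [det2 p q]. Comparison with 2 [det2 p q] bounds the gauge by
   1. Symmetry covers a < 0. *)
have pos x y a b : 0 <= a -> B (x, y) ->
    (x, y) = (a * p.1 + b * q.1, a * p.2 + b * q.2) -> `|a| + `|b| <= 1.
  move=> a0 Bxy [xE yE]; rewrite (ger0_norm a0).
  have [b0|b0] := leP 0 b.
    have := @hexagon_area _ B p (x, y) q clB cB sB p0; rewrite AB lee_fin.
    have -> : det2 p (x, y) = b * det2 p q by rewrite xE yE /det2/=; ring.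
    have -> : det2 (x, y) q = a * det2 p q by rewrite xE yE /det2/=; ring.
    rewrite !mulr_ge0 ?(ltW D)// => /(_ isT isT isT Bp Bxy Bq).
    have -> : b * det2 p q + det2 p q + a * det2 p q = (1 + (a + b)) * det2 p q by ring.
    by rewrite ler_pM2r// (ger0_norm b0); lra.
  have Bq' : B (- q.1, - q.2) by case: q Bq {D AB q0 xE yE} => *; exact: sB.
  have q0' : (- q.1, - q.2) != 0 :> R * R by rewrite -oppr_eq0 in q0.
  have := @hexagon_area _ B (- q.1, - q.2) (x, y) p clB cB sB q0'; rewrite AB lee_fin.
  have -> : det2 (- q.1, - q.2) (x, y) = a * det2 p q by rewrite xE yE /det2/=; ring.
  have -> : det2 (x, y) p = - b * det2 p q by rewrite xE yE /det2/=; ring.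
  have -> : det2 (- q.1, - q.2) p = det2 p q by rewrite /det2/=; ring.
  have nb0 : 0 <= - b by lra.
  rewrite !mulr_ge0 ?(ltW D)// => /(_ isT isT isT Bq' Bxy Bp).
  have -> : a * det2 p q + det2 p q + - b * det2 p q = (1 + (a - b)) * det2 p q by ring.
  by rewrite ler_pM2r// (ltr0_norm b0); lra.
move=> [x y] Bxy; have [a [b xyE]] := pgram_coord x y (lt0r_neq0 D).
exists a, b; split => //; have [a0|a0] := leP 0 a; first exact: pos xyE.
rewrite -(normrN a) -(normrN b); apply: pos (sB _ _ Bxy) _; first lra.
by move: xyE => [-> ->]; congr (_, _); ring.
Qed.

Lemma conv_hull_pgram p q :
  conv_hull [:: p; (- p.1, - p.2); q; (- q.1, - q.2)] = pgram p q.
Proof.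
case: p q => [p1 p2] [q1 q2]; apply/seteqP; split => x.
  move=> [l [sl al s1 ->]]; move: l sl al s1 => [|l0 [|l1 [|l2 [|l3 []]]]]//= _.
  rewrite !big_ord_recr !big_ord0 /= => /and5P[h0 h1 h2 h3 _] l1E.
  exists (l0 - l1), (l2 - l3); split; last by congr (_, _) => /=; ring.
  have := ler_normB l0 l1; have := ler_normB l2 l3.
  by rewrite (ger0_norm h0) (ger0_norm h1) (ger0_norm h2) (ger0_norm h3); lra.
move=> [a [b [ab ->]]] /=.
have [a1 a2] : a <= `|a| /\ - `|a| <= a.
  by split; [exact: ler_norm|rewrite lerNl -normrN ler_norm].
have [b1 b2] : b <= `|b| /\ - `|b| <= b.
  by split; [exact: ler_norm|rewrite lerNl -normrN ler_norm].
pose r := (1 - `|a| - `|b|) / 4.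
exists [:: (`|a| + a) / 2 + r; (`|a| - a) / 2 + r; (`|b| + b) / 2 + r; (`|b| - b) / 2 + r].
rewrite !big_ord_recr !big_ord0 /=; split => //.
- by rewrite /r; apply/and5P; split => //; lra.
- by rewrite /r; field.
- by rewrite /r; congr (_, _); field.
Qed.

Lemma closed_pgram p q : 0 < det2 p q -> closed (pgram p q).
Proof.
case: p q => [p1 p2] [q1 q2]; rewrite /det2/= => D.
have Dn : p1 * q2 - p2 * q1 != 0 by rewrite gt_eqF.
set D0 := p1 * q2 - p2 * q1 in D Dn.
pose f (x : R * R) := `|q2 / D0 * x.1 + - q1 / D0 * x.2 + 0| +
  `|- p2 / D0 * x.1 + p1 / D0 * x.2 + 0|.
have -> : pgram (p1, p2) (q1, q2) = f @^-1` [set y | y <= 1].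
  apply/seteqP; split => [x [a [b [ab ->]]]|[x y] fx]; rewrite /f/=.
    suff [-> ->] : (q2 / D0 * (a * p1 + b * q1) + - q1 / D0 * (a * p2 + b * q2) + 0 = a /\
       - p2 / D0 * (a * p1 + b * q1) + p1 / D0 * (a * p2 + b * q2) + 0 = b) by [].
    by rewrite /D0; split; field.
  exists (q2 / D0 * x + - q1 / D0 * y + 0), (- p2 / D0 * x + p1 / D0 * y + 0).
  by split => //=; congr (_, _); rewrite /D0; field.
apply: closed_comp; last exact: closed_le.
move=> x _; apply: cvgD; apply: cvg_norm; exact: continuous_linear2.
Qed.

Lemma area_pgram p q : 0 < det2 p q -> area (pgram p q) = (2 * det2 p q)%:E.
Proof.
move=> D; have cl := closed_pgram D.
have pp : pgram p q p by exists 1, 0; rewrite normr1 normr0 addr0; split => //; case: (p) => *; congr (_, _) => /=; ring.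
have pq : pgram p q q by exists 0, 1; rewrite normr1 normr0 add0r; split => //; case: (q) => *; congr (_, _) => /=; ring.
have cp : convex_set2 (pgram p q).
  move=> _ _ [a [b [ab ->]]] [a' [b' [ab' ->]]] t /andP[t0 t1].
  exists (t * a + (1 - t) * a'), (t * b + (1 - t) * b'); split.
    have t1' : 0 <= 1 - t by lra.
    have := ler_normD (t * a) ((1 - t) * a'); have := ler_normD (t * b) ((1 - t) * b').
    rewrite !normrM (ger0_norm t0) (ger0_norm t1').
    have : t * (`|a| + `|b|) <= t * 1 by rewrite ler_wpM2l.
    have : (1 - t) * (`|a'| + `|b'|) <= (1 - t) * 1 by rewrite ler_wpM2l.
    lra.
  by rewrite /padd /pscale/=; congr (_, _); ring.
have sp : sym0 (pgram p q).
  move=> x y [a [b [ab [-> ->]]]]; exists (- a), (- b); rewrite !normrN; split => //.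
  by congr (_, _); ring.
apply/eqP; rewrite eq_le; apply/andP; split; last first.
  have p0 : p != 0 by apply: contraTneq D => ->; rewrite /det2/= !mul0r subr0 ltxx.
  have dqq : det2 q q = 0 by rewrite /det2; ring.
  have := @hexagon_area _ (pgram p q) p q q cl cp sp p0 (ltW D) (ltW D).
  rewrite dqq addr0 => /(_ (lexx _) pp pq pq); congr (_ <= _)%E; congr EFin; ring.
set d := det2 p q in D *.
have dn : d != 0 by rewrite gt_eqF.
(* [G] has determinant 1 and sends (d, 0) to p and (0, 1) to q. The preimage is therefore |x|/d +
   |y| <= 1, whose slices have length 2(1 - |x|/d). *)
pose G := affine2 (p.1 / d) q.1 (p.2 / d) q.2 0 0.
have <- : area (G @^-1` pgram p q) = area (pgram p q).
  apply: area_affine => //; rewrite -[RHS](expr1n _ 2); congr (_ ^+ 2).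
  by rewrite /d /det2; field.
have mG : measurable (G @^-1` pgram p q) by apply: closed_measurable2; exact: closed_affine2.
have GE x y : (G @^-1` pgram p q) (x, y) -> `|x| / d + `|y| <= 1.
  move=> [a [b [ab]]]; rewrite /G /affine2/= => -[E1 E2].
  suff [-> ->] : x = a * d /\ y = b by rewrite normrM (gtr0_norm D) mulfK.
  have dE : d = p.1 * q.2 - p.2 * q.1 by [].
  split.
    have : d * x = d * (a * d).
      transitivity (d * (q.2 * (p.1 / d * x + q.1 * y + 0) - q.1 * (p.2 / d * x + q.2 * y + 0))).
        have -> : q.2 * (p.1 / d * x + q.1 * y + 0) - q.1 * (p.2 / d * x + q.2 * y + 0) =
           (p.1 * q.2 - p.2 * q.1) / d * x by field.
        by rewrite -dE; field.
      by rewrite E1 E2; congr (_ * _); rewrite dE; ring.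
    by move/mulfI; apply.
  have : d * y = d * b.
    transitivity (p.1 * (p.2 / d * x + q.2 * y + 0) - p.2 * (p.1 / d * x + q.1 * y + 0)).
      by rewrite {1}dE; field.
    by rewrite E1 E2 dE; ring.
  by move/mulfI; apply.
have xs x y : (G @^-1` pgram p q) (x, y) -> `|x| <= d.
  move=> /GE; have := normr_ge0 y => y0 h; have : `|x| / d <= 1 by lra.
  by rewrite ler_pdivrMr// mul1r.
rewrite (@area_slice _ _ (- d) d)//; last by move=> [x y] /xs /=; rewrite ler_norml.
have d0 := ltW D.
rewrite (@slice_area_split _ _ (- d) 0 d)//; last by rewrite oppr_le0.
have tl : (slice_area (G @^-1` pgram p q) (- d) 0 <= d%:E)%E.
  have := @slice_area_le_linear _ (G @^-1` pgram p q) 2 (2 / d) (- d) 0 mG.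
  have -> : (0 - - d) * (2 + 2 / d * (- d + 0) / 2) = d by field.
  apply; first by rewrite oppr_le0.
  move=> x /andP[x1 x2].
  have xd : 0 <= 1 + x / d.
    have : - x / d <= 1 by rewrite ler_pdivrMr//; lra.
    lra.
  have -> : 2 + 2 / d * x = (1 + x / d) - (- (1 + x / d)) by field.
  apply: xsection_measure_le => //; first lra.
  by move=> z /GE; rewrite (ler0_norm x2) -ler_norml; lra.
have tr : (slice_area (G @^-1` pgram p q) 0 d <= d%:E)%E.
  have := @slice_area_le_linear _ (G @^-1` pgram p q) 2 (- 2 / d) 0 d mG d0.
  have -> : (d - 0) * (2 + (- 2 / d) * (0 + d) / 2) = d by field.
  apply=> x /andP[x1 x2].
  have xd : 0 <= 1 - x / d.
    have : x / d <= 1 by rewrite ler_pdivrMr//; lra.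
    lra.
  have -> : 2 + (- 2 / d) * x = (1 - x / d) - (- (1 - x / d)) by field.
  apply: xsection_measure_le => //; first lra.
  by move=> z /GE; rewrite (ger0_norm x1) -ler_norml; lra.
by apply: le_trans (leeD tl tr) _; rewrite -EFinD lee_fin; lra.
Qed.

End SymmetricBodies.

(** * The lower bound on the area *)

Section LowerBound.
Context {R : realType}.
Implicit Types (B : set (R * R)).

(** A lower bound [m] for the support function at nonzero lattice vectors, given by witnesses; for
    symmetric B it says that every lattice direction has width at least 2m. *)
Definition wide B (m : R) := forall u v : int, (u, v) != (0, 0) ->
  exists x y, B (x, y) /\ m <= u%:~R * x + v%:~R * y.

(** The hexagon with r = q degenerates to a parallelogram. *)
Lemma det_le_area B (p q : R * R) : sym_body B -> 0 < det2 p q -> B p -> B q ->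
  ((2 * det2 p q)%:E <= area B)%E.
Proof.
move=> [clB cB sB _] D Bp Bq.
have p0 : p != 0 by apply: contraTneq D => ->; rewrite /det2/= !mul0r subr0 ltxx.
have dqq : det2 q q = 0 by rewrite /det2; ring.
have := @hexagon_area _ B p q q clB cB sB p0 (ltW D) (ltW D).
rewrite dqq addr0 => /(_ (lexx _) Bp Bq Bq); congr (_ <= _)%E; congr EFin; ring.
Qed.

(** The alternatives separate the configurations in which equality is possible from those with
    strict inequality. In the first, (m, s') and q already span a parallelogram of area at least
    2m^2. The value [s'] differs from [s] only when (m, 0) is found to lie in B. *)
Lemma lower_bound_split B (m s : R) : sym_body B -> 0 < m -> 0 <= s < m -> B (m, s) ->
  (forall x y, B (x, y) -> `|x| <= m) ->
  (exists x y, B (x, y) /\ m <= y) -> (exists x y, B (x, y) /\ m <= y - x) ->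
  (exists s' q1 q2, [/\ 0 <= s' < m, B (m, s'), B (q1, q2) & m ^+ 2 <= m * q2 - s' * q1])
  \/ ((2 * m ^+ 2)%:E < area B)%E.
Proof.
move=> bB m0 /andP[s0 sm] Bp Bm [q1 [q2 [Bq mq]]] [r1 [r2 [Br mr]]].
have [q10|q10] := leP q1 0.
  by left; exists s, q1, q2; rewrite s0 sm; split => //; nra.
have [r10|r10] := leP 0 r1.
  by left; exists s, r1, r2; rewrite s0 sm; split => //; nra.
have := Bm _ _ Bq; have := Bm _ _ Br; rewrite !ler_norml => /andP[rm _] /andP[_ qm].
have [clB cB sB _] := bB.
have p0 : (m, s) != 0 by apply/eqP => -[] E _; move: m0; rewrite E ltxx.
pose b := - r1.
have [E|bm] := eqVneq b m.
  have [r20|r20] := leP r2 0.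
    have r2E : r2 = 0 by move: mr; rewrite (_ : r1 = - m) -?E ?opprK//; lra.
    left; exists 0, q1, q2; rewrite lexx m0; split => //; last by nra.
    by have := sB _ _ Br; rewrite r2E oppr0 -/b E.
  right.
  have := @hexagon_area _ B (m, s) (q1, q2) (r1, r2) clB cB sB p0; rewrite /det2/=.
  have rE : r1 = - m by rewrite -E /b opprK.
  rewrite rE => H.
  apply: lt_le_trans (H _ _ _ Bp Bq _).
  - rewrite lte_fin.
    have h1 : 0 <= (q2 - m) * (m + m) by nra.
    have h2 : 0 < r2 * (m + q1) by nra.
    have h3 : 0 <= s * (m - q1) by nra.
    nra.
  - by nra.
  - by nra.
  - by nra.
  - by rewrite -rE.
right.
have bm' : b < m by rewrite lt_neqAle bm /b; lra.
have := @hexagon_area _ B (m, s) (q1, q2) (r1, r2) clB cB sB p0; rewrite /det2/=.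
have rE : r1 = - b by rewrite /b opprK.
have b0 : 0 < b by rewrite /b; lra.
rewrite rE in Br mr *.
have h4 : 0 < q1 / m by rewrite divr_gt0.
have h5 : q1 / m <= 1 by rewrite ler_pdivrMr// mul1r.
move=> H; apply: lt_le_trans (H _ _ _ Bp Bq Br).
- rewrite lte_fin.
  have h1 : 0 <= (q2 - m) * (m + b) by nra.
  have h2 : 0 <= (r2 - (m - b)) * (m + q1) by nra.
  (* Inserting q2 >= m and r2 >= m - b, the hexagon exceeds 2m^2 by at least q1(m - s - b) + s b.
     This is linear in q1, with value s b at 0 and (m - s)(m - b) > 0 at m, so it is positive for 0
     < q1 <= m. *)
  have h3 : 0 < (1 - q1 / m) * (s * b) + (q1 / m) * ((m - s) * (m - b)).
    apply: ltr_wpDl; first by apply: mulr_ge0; [lra|exact: mulr_ge0 (ltW b0)].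
    by apply: mulr_gt0 => //; apply: mulr_gt0; lra.
  have h6 : (1 - q1 / m) * (s * b) + (q1 / m) * ((m - s) * (m - b)) =
     q1 * (m - s - b) + s * b by field; rewrite gt_eqF.
  rewrite h6 in h3.
  nra.
- by nra.
- by nra.
- by nra.
Qed.

(** A linear functional on a parallelogram is largest at a vertex. *)
Lemma pgram_functional (p q : R * R) (u v x y m : R) : 0 < m -> pgram p q (x, y) ->
  m <= u * x + v * y ->
  m <= `|u * p.1 + v * p.2| \/ m <= `|u * q.1 + v * q.2|.
Proof.
move=> m0 [a [b [ab [-> ->]]]] h.
have [|hp] := leP m `|u * p.1 + v * p.2|; first by left.
have [|hq] := leP m `|u * q.1 + v * q.2|; first by right.
exfalso.
have : u * (a * p.1 + b * q.1) + v * (a * p.2 + b * q.2) =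
  a * (u * p.1 + v * p.2) + b * (u * q.1 + v * q.2) by ring.
move=> E; rewrite E in h.
have [a0 b0] := (normr_ge0 a, normr_ge0 b).
have h1 := ler_norm (a * (u * p.1 + v * p.2)).
have h2 := ler_norm (b * (u * q.1 + v * q.2)).
rewrite normrM in h1; rewrite normrM in h2.
set P := `|u * p.1 + v * p.2| in hp h1; set Q := `|u * q.1 + v * q.2| in hq h2.
have [A|A] := ltP 0 `|a|.
  have : `|a| * P < `|a| * m by rewrite ltr_pM2l.
  have : `|b| * Q <= `|b| * m by rewrite ler_wpM2l// ltW.
  have : (`|a| + `|b|) * m <= 1 * m by rewrite ler_wpM2r// ltW.
  by lra.
have a00 : `|a| = 0 by lra.
have [C|C] := ltP 0 `|b|.
  have : `|b| * Q < `|b| * m by rewrite ltr_pM2l.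
  have : `|b| * m <= 1 * m by rewrite ler_pM2r//; lra.
  by move: h1; rewrite a00 mul0r; lra.
have b00 : `|b| = 0 by lra.
by move: h1 h2; rewrite a00 b00 !mul0r; lra.
Qed.

Lemma lower_bound B (m s : R) : sym_body B -> 0 < m -> 0 <= s < m -> B (m, s) ->
  (forall x y, B (x, y) -> `|x| <= m) -> wide B m ->
  ((2 * m ^+ 2)%:E <= area B)%E.
Proof.
move=> bB m0 sm Bp Bm wB.
have [//|x1 [y1 [B1]]] := wB 0 1; rewrite mul0r add0r mul1r => my1.
have [//|x2 [y2 [B2]]] := wB (-1) 1; rewrite mulN1r mul1r addrC => my2.
have [] := @lower_bound_split B m s bB m0 sm Bp Bm.
- by exists x1, y1.
- by exists x2, y2.
- move=> [s' [q1 [q2 [_ Bp' Bq D]]]].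
  have D' : m ^+ 2 <= det2 (m, s') (q1, q2) by [].
  have D0 : 0 < det2 (m, s') (q1, q2) by apply: lt_le_trans D'; rewrite exprn_gt0.
  by apply: le_trans (det_le_area bB D0 Bp' Bq); rewrite lee_fin; lra.
- exact: ltW.
Qed.

Lemma lower_bound_eq B (m s : R) : sym_body B -> 0 < m -> 0 <= s < m -> B (m, s) ->
  (forall x y, B (x, y) -> `|x| <= m) -> wide B m -> area B = (2 * m ^+ 2)%:E ->
  (exists q1, B = pgram (m, 0) (q1, m)) \/ (exists s', B = pgram (m, s') (0, m)).
Proof.
move=> bB m0 sm Bp Bm wB AB.
have [//|x1 [y1 [B1]]] := wB 0 1; rewrite mul0r add0r mul1r => my1.
have [//|x2 [y2 [B2]]] := wB (-1) 1; rewrite mulN1r mul1r => my2.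
have [] := @lower_bound_split B m s bB m0 sm Bp Bm.
- by exists x1, y1.
- by exists x2, y2; rewrite addrC.
- move=> [s' [q1 [q2 [/andP[s0 s'm] Bp' Bq D]]]].
  have D' : m ^+ 2 <= det2 (m, s') (q1, q2) by [].
  have D0 : 0 < det2 (m, s') (q1, q2) by apply: lt_le_trans D'; rewrite exprn_gt0.
  have := det_le_area bB D0 Bp' Bq; rewrite AB lee_fin => D2.
  have DE : det2 (m, s') (q1, q2) = m ^+ 2 by lra.
  have [clB cB sB _] := bB.
  have BE : B = pgram (m, s') (q1, q2).
    by apply: pgram_of_area => //; rewrite DE AB.
  move: DE; rewrite /det2/= => DE.
  have := Bm _ _ Bq; rewrite ler_norml => /andP[q1m q1m'].
  rewrite BE in B1 B2.
  have Q2 : m * q2 = m * m + s' * q1 by rewrite -expr2; lra.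
  have q2s : m - s' <= q2.
    by rewrite -(ler_pM2l m0) Q2; nra.
  have [S0|Sn] := eqVneq s' 0.
    left; exists q1; rewrite BE S0; congr (pgram _ (_, _)).
    by move: Q2; rewrite S0 mul0r addr0; apply: mulfI; rewrite gt_eqF.
  right; exists s'; rewrite BE.
  have s'0 : 0 < s' by rewrite lt_neqAle eq_sym Sn.
  (* For 0 < s' < m the vertices ±(m, s') stay below [m] in the directions e2 and e2 - e1, so ±q
     must reach it. The first gives m <= q2, hence q1 >= 0; the second gives m <= q2 - q1, hence q1
     <= 0. Both use m q2 = m^2 + s' q1. *)
  suff q10 : q1 = 0.
    rewrite q10 in Q2 *; congr (pgram _ (_, _)).
    by move: Q2; rewrite mulr0 addr0; apply: mulfI; rewrite gt_eqF.
  have q20 : 0 < q2 by lra.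
  have q1_ge0 : 0 <= q1.
    have mq2 : m <= q2.
      have := @pgram_functional _ _ 0 1 _ _ _ m0 B1.
      rewrite /= !mul0r !add0r !mul1r => /(_ my1) [].
        by rewrite ger0_norm//; lra.
      by rewrite gtr0_norm.
    rewrite -(ler_pM2l s'0) mulr0; have : m * m <= m * q2 by rewrite ler_pM2l.
    by lra.
  have qq : m * (q2 - q1) = m * m - (m - s') * q1 by rewrite mulrBr Q2; ring.
  have ms : 0 < m - s' by lra.
  have mqq : 0 < q2 - q1.
    rewrite -(pmulr_rgt0 _ m0) qq.
    have : (m - s') * q1 <= (m - s') * m by rewrite ler_pM2l.
    have : 0 < m * s' by exact: mulr_gt0.
    by lra.
  have mqq2 : m <= q2 - q1.
    have := @pgram_functional _ _ (-1) 1 _ _ _ m0 B2.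
    rewrite /= !mulN1r !mul1r => /(_ my2) [].
      by rewrite ltr0_norm; lra.
    by rewrite (addrC (- q1)) gtr0_norm.
  have : m * m <= m * (q2 - q1) by rewrite ler_pM2l.
  rewrite qq => h; have : (m - s') * q1 <= 0 by lra.
  by rewrite pmulr_rle0//; lra.
- by rewrite AB ltxx.
Qed.

End LowerBound.

(** * The upper bound on the area *)

Section UpperBound.
Context {R : realType}.
Local Notation mu := (@lebesgue_measure R).
Implicit Types (B : set (R * R)).

Lemma linear_max B (u v : R) : closed B -> bounded2 B -> B !=set0 ->
  exists x y, B (x, y) /\ forall x' y', B (x', y') -> u * x' + v * y' <= u * x + v * y.
Proof.
move=> clB [M BM] B0.
have cB : compact B.
  apply: (@subclosed_compact _ B (`[- M, M]%classic `*` `[- M, M]%classic)) => //.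
    by apply: compact_setX; exact: segment_compact.
  by move=> [x y] /BM [/= xM yM]; split; rewrite /= in_itv/= -ler_norml.
have cf : {within B, continuous (fun z : R * R => u * z.1 + v * z.2 + 0)}.
  by apply: continuous_subspaceT; exact: continuous_linear2.
have [[x y]] := compact_EVT_max B0 cB cf.
rewrite inE => Bxy H; exists x, y; split => // x' y' Bx'.
by have := H (x', y'); rewrite inE /= !addr0; exact.
Qed.

Lemma int2_vert B (x y0 y1 y : R) : convex_set2 B -> int2 B x y0 -> B (x, y1) ->
  y0 <= y < y1 \/ y1 < y <= y0 -> int2 B x y.
Proof.
move=> cB i0 B1 H.
have d0 : y1 - y0 != 0 by case: H => /andP[? ?]; rewrite subr_eq0; [rewrite gt_eqF|rewrite lt_eqF]; lra.
apply: (int2_segment (t := (y - y0) / (y1 - y0)) cB B1 i0); last 2 first.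
- by ring.
- by field.
case: H => /andP[h1 h2].
  have d1 : 0 < y1 - y0 by lra.
  by apply/andP; split; [apply: divr_ge0; lra|rewrite ltr_pdivrMr//; lra].
rewrite -mulrNN -invrN.
have d1 : 0 < - (y1 - y0) by lra.
by apply/andP; split; [apply: divr_ge0; lra|rewrite ltr_pdivrMr//; lra].
Qed.

Lemma nearest_int (c : R) : exists z : int, `|z%:~R - c| <= 1 / 2.
Proof.
exists (Num.floor (c + 1 / 2)).
have := floor_le (c + 1 / 2); have := floorD1_gt (c + 1 / 2).
by rewrite ler_norml intrD; lra.
Qed.

Lemma int_in_long_interval (a b : R) : 1 < b - a -> exists z : int, a < z%:~R < b.
Proof.
move=> ab; exists (Num.floor a + 1).
have := floor_le a; have := floorD1_gt a.
by rewrite intrD; lra.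
Qed.

(** * Lengths of vertical chords *)

Section Chords.
Variables (B : set (R * R)) (m s c1 c2 : R).
Hypothesis bB : sym_body B.
Hypothesis bdB : bounded2 B.
Hypothesis m_gt : 1 / 2 < m.
Hypothesis Bp : B (m, s).
Hypothesis Bm : forall x y, B (x, y) -> `|x| <= m.
Hypothesis free : forall z1 z2 : int, ~ int2 B (z1%:~R - c1) (z2%:~R - c2).

Let clB : closed B. Proof. by case: bB. Qed.
Let cB : convex_set2 B. Proof. by case: bB. Qed.
Let sB : sym0 B. Proof. by case: bB. Qed.
Let m0 : 0 < m. Proof. by apply: lt_trans m_gt; rewrite divr_gt0. Qed.
Let mB : measurable B. Proof. exact: closed_measurable2. Qed.

(** The axis from -(m, s) to (m, s) supplies an interior point on every chord with |x| < m. *)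
Lemma axis_pt (x : R) : `|x| < m -> int2 B x (x / m * s).
Proof.
move=> xm; apply: (int2_scale (t := x / m) bB _ Bp) => //.
  by rewrite normrM normfV (gtr0_norm m0) ltr_pdivrMr// mul1r.
by field; rewrite gt_eqF.
Qed.

(** Only the upper ends are chosen: by symmetry the lower end of the chord at [x] is
    [- up (- x)]. *)
Lemma upper_chord : exists up : R -> R, forall x, `|x| <= m ->
  B (x, up x) /\ forall y, B (x, y) -> y <= up x.
Proof.
suff : forall x, exists y, `|x| <= m -> B (x, y) /\ forall y', B (x, y') -> y' <= y.
  by move=> /choice[up H]; exists up.
move=> x; have [xm|xm] := leP `|x| m; last by exists 0.
pose S := B `&` ((fun z : R * R => 1 * z.1 + 0 * z.2 + 0) @^-1` [set x]).
have clS : closed S.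
  apply: closedI => //; apply: closed_comp; last exact: closed_eq.
  by move=> z _; exact: continuous_linear2.
have SE z : S (x, z) = B (x, z).
  by apply/propext; split => [[]//|Bz]; split => //=; ring.
have bdS : bounded2 S by have [M BM] := bdB; exists M => z [/BM].
have S0 : S !=set0.
  exists (x, x / m * s); rewrite SE.
  have xm1 : `|x / m| <= 1 by rewrite normrM normfV (gtr0_norm m0) ler_pdivrMr// mul1r.
  apply: (pgram_sub cB sB Bp Bp); exists (x / m), 0; rewrite normr0 addr0; split => //=.
  by congr (_, _); field; rewrite gt_eqF.
have [x' [y [[Bxy xE] H]]] := linear_max 0 1 clS bdS S0.
exists y => _; have xx : x' = x by move: xE => /= <-; ring.
rewrite xx in Bxy; split => // y' By'.
by have := H x y'; rewrite SE !mul0r !add0r !mul1r; exact.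
Qed.

(* The chord length l(x) = up x + up (-x) is even and concave, and it is at most
   1 on some lattice column |x| <= 1/2, hence at 1/2; -k is a supergradient there. *)
Lemma upper_bound_param : exists la k l0 : R,
  [/\ [/\ 0 <= k, la <= 1, k * (m - 1 / 2) <= la & la <= l0], B (0, l0 / 2) &
    forall d : R, 0 <= d <= m -> (area B <=
      (2 * (d * l0 + (m - d) * (la + k / 2 - k * (d + m) / 2)))%:E)%E].
Proof.
have mg := m_gt; have m_gt0 := m0.
have [up upP] := upper_chord.
pose l x := up x + up (- x).
have lN x : l (- x) = l x by rewrite /l opprK addrC.
have upB x : `|x| <= m -> B (x, up x) by move/upP => [].
have up_le x y : B (x, y) -> y <= up x by move=> Bxy; apply: (upP x (Bm Bxy)).2.
have lo_le x y : B (x, y) -> - up (- x) <= y.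
  by move=> /sB /up_le; rewrite lerNl.
have loB x : `|x| <= m -> B (x, - up (- x)).
  by rewrite -normrN => /upB /sB; rewrite opprK.
have l_ge0 x : `|x| <= m -> 0 <= l x.
  by move=> xm; have := lo_le _ _ (upB _ xm); rewrite /l; lra.
have conc (x y z t : R) : `|x| <= m -> `|y| <= m -> 0 <= t <= 1 -> z = t * x + (1 - t) * y ->
    t * l x + (1 - t) * l y <= l z.
  move=> xm ym t01 zE.
  have /up_le h1 : B (z, t * up x + (1 - t) * up y).
    by apply: (convex_ptE (t := t) cB (upB _ xm) (upB _ ym)).
  have /up_le h2 : B (- z, t * up (- x) + (1 - t) * up (- y)).
    have xm' : `|- x| <= m by rewrite normrN.
    have ym' : `|- y| <= m by rewrite normrN.
    by apply: (convex_ptE (t := t) cB (upB _ xm') (upB _ ym')) => //; rewrite zE; ring.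
  by rewrite /l; lra.
have hm : `|1 / 2 : R| <= m by rewrite ger0_norm; lra.
have half_le (t : R) : `|t| <= 1 / 2 -> l (1 / 2) <= l t.
  rewrite ler_norml => /andP[t1 t2].
  have := conc (1 / 2) (- (1 / 2)) t (t + 1 / 2).
  rewrite normrN lN => /(_ hm hm).
  have -> : 0 <= t + 1 / 2 <= 1 by lra.
  have tE : t = (t + 1 / 2) * (1 / 2) + (1 - (t + 1 / 2)) * - (1 / 2) by field.
  move=> /(_ isT tE); lra.
have la1 : l (1 / 2) <= 1.
  (* [t] is the offset of the lattice column nearest to the centre. A chord there longer than 1 has
     a lattice point strictly between its ends, and such a point is interior because the chord meets
     the axis in an interior point. *)
  have [z1 z1c] := nearest_int c1; set t := z1%:~R - c1 in z1c.
  apply: le_trans (half_le _ z1c) _; rewrite leNgt; apply/negP => lt1.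
  have [z2 /andP[h1 h2]] : exists z : int, c2 - up (- t) < z%:~R < c2 + up t.
    by apply: int_in_long_interval; move: lt1; rewrite /l; lra.
  apply: (free (z1 := z1) (z2 := z2)); rewrite -/t.
  have tm : `|t| < m by apply: le_lt_trans z1c _.
  have i0 := axis_pt tm.
  have [h|h] := leP (t / m * s) (z2%:~R - c2).
    by apply: (int2_vert cB i0 (upB _ (ltW tm))); left; lra.
  by apply: (int2_vert cB i0 (loB _ (ltW tm))); right; lra.
set la := l (1 / 2) in half_le la1 *.
have lNx (x t : R) : `|x| <= m -> `|t| <= x -> 0 < x -> l x <= l t.
  move=> xm; rewrite ler_norml => /andP[t1 t2] x0.
  have := conc x (- x) t ((t + x) / (2 * x)).
  rewrite normrN lN => /(_ xm xm).
  have -> : 0 <= (t + x) / (2 * x) <= 1.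
    by apply/andP; split; [apply: divr_ge0; lra|rewrite ler_pdivrMr; lra].
  have xE : t = (t + x) / (2 * x) * x + (1 - (t + x) / (2 * x)) * - x.
    by field; rewrite gt_eqF.
  move=> /(_ isT xE); lra.
(* Slopes of [l] from 1/2 to points on its right; their supremum is the right derivative at 1/2. By
   concavity each slope from the left bounds [S] from above, so the line of slope [sup S] through
   (1/2, la) lies above [l] on both sides. *)
pose S := [set sg | exists2 x : R, 1 / 2 < x <= m & sg = (l x - la) / (x - 1 / 2)].
have S0 : S !=set0 by exists ((l m - la) / (m - 1 / 2)), m => //; rewrite m_gt lexx.
have xle x : 0 <= x -> x <= m -> `|x| <= m by move=> x0; rewrite ger0_norm.
have S_ub0 : ubound S 0.
  move=> _ [x /andP[x1 x2] ->].
  have : l x <= la by apply: lNx; rewrite ?xle ?ger0_norm; lra.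
  by move=> h; rewrite ler_pdivrMr ?mul0r; lra.
have S_ub (y : R) : 0 <= y < 1 / 2 -> ubound S ((la - l y) / (1 / 2 - y)).
  move=> /andP[y0 y1] _ [x /andP[x1 x2] ->].
  have ym : `|y| <= m by rewrite xle//; lra.
  have xm : `|x| <= m by rewrite xle//; lra.
  have xy : 0 < x - y by lra.
  have := conc y x (1 / 2) ((x - 1 / 2) / (x - y)) ym xm.
  have -> : 0 <= (x - 1 / 2) / (x - y) <= 1.
    by apply/andP; split; [apply: divr_ge0; lra|rewrite ler_pdivrMr; lra].
  have hE : 1 / 2 = (x - 1 / 2) / (x - y) * y + (1 - (x - 1 / 2) / (x - y)) * x.
    by field; rewrite gt_eqF.
  move=> /(_ isT hE).
  rewrite -/la -(ler_pM2r xy).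
  have -> : ((x - 1 / 2) / (x - y) * l y + (1 - (x - 1 / 2) / (x - y)) * l x) * (x - y)
     = (x - 1 / 2) * l y + (1 / 2 - y) * l x by field; rewrite gt_eqF.
  move=> h; rewrite ler_pdivrMr; last lra.
  rewrite mulrAC ler_pdivlMr; last lra.
  lra.
pose k := - sup S.
have k0 : 0 <= k by rewrite /k oppr_ge0; exact: ge_sup.
have lr (x : R) : 1 / 2 <= x <= m -> l x <= la + k / 2 - k * x.
  rewrite le_eqVlt => /andP[/predU1P[<-|x1] x2]; first by rewrite -/la; lra.
  have : (l x - la) / (x - 1 / 2) <= sup S.
    by apply: ub_le_sup; [exists 0|exists x => //; rewrite x1].
  have -> : sup S = - k by rewrite /k opprK.
  by rewrite ler_pdivrMr; lra.
have ll (y : R) : 0 <= y <= m -> l y <= la + k / 2 - k * y.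
  move=> /andP[y0 ym]; have [y1|y1] := leP (1 / 2) y; first by apply: lr; rewrite y1.
  have : sup S <= (la - l y) / (1 / 2 - y) by apply: ge_sup => //; apply: S_ub; rewrite y0.
  have -> : sup S = - k by rewrite /k opprK.
  by rewrite ler_pdivlMr; lra.
have l0_le (x : R) : `|x| <= m -> l x <= l 0.
  move=> xm; have xm' : `|- x| <= m by rewrite normrN.
  have := conc _ _ 0 (1 / 2) xm xm'; rewrite lN.
  have h01 : 0 <= (1 / 2 : R) <= 1 by apply/andP; split; lra.
  have E : 0 = 1 / 2 * x + (1 - 1 / 2) * - x by field.
  move=> /(_ h01 E); lra.
exists la, k, (l 0); split.
- split => //.
    have := lr m; rewrite lexx (ltW m_gt) => /(_ isT).
    have := l_ge0 m; rewrite (xle m (ltW m0) (lexx m)) => /(_ isT).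
    by lra.
  by apply: half_le; rewrite normr0; lra.
- have := upB 0; rewrite normr0 => /(_ (ltW m0)).
  by have -> : l 0 / 2 = up 0 by rewrite /l oppr0; field.
have muB x : `|x| <= m -> (mu (xsection B x) <= (l x)%:E)%E.
  move=> xm; have -> : l x = up x - - up (- x) by rewrite opprK.
  apply: xsection_measure_le => //; first exact: lo_le (upB _ xm).
  by move=> z Bz; rewrite lo_le// up_le.
(* For |x| <= d the chord is estimated by [l 0], elsewhere by the line. The choice d = 0 gives the
   bound itself; positive d is what forces the peak at 0 in the equality case. *)
clearbody k; move=> d /andP[d0 dm].
rewrite (@area_slice _ _ (- m) m)//; last by move=> [x y] /Bm; rewrite ler_norml.
rewrite (@slice_area_split _ _ (- m) 0 m)//; [|lra|lra].
rewrite (@slice_area_split _ _ (- m) (- d) 0)//; [|lra|lra].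
rewrite (@slice_area_split _ _ 0 d m)//.
have s1 := @slice_area_le_linear _ B (la + k / 2) k (- m) (- d) mB.
have s2 := @slice_area_le_linear _ B (l 0) 0 (- d) 0 mB.
have s3 := @slice_area_le_linear _ B (l 0) 0 0 d mB d0.
have s4 := @slice_area_le_linear _ B (la + k / 2) (- k) d m mB dm.
have {}s1 := s1 _ _; have {}s2 := s2 _ _.
apply: le_trans (leeD (leeD (s1 _ _) (s2 _ _)) (leeD (s3 _) (s4 _))) _.
- by lra.
- move=> x /andP[x1 x2].
  apply: le_trans (muB _ _) _; first by rewrite ler_norml; lra.
  by rewrite lee_fin -lN; have := ll (- x); rewrite mulrN opprK; apply; lra.
- by lra.
- move=> x /andP[x1 x2].
  have xm : `|x| <= m by rewrite ler_norml; lra.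
  by apply: le_trans (muB _ xm) _; rewrite lee_fin mul0r addr0; exact: l0_le.
- move=> x /andP[x1 x2].
  have xm : `|x| <= m by rewrite ler_norml; lra.
  by apply: le_trans (muB _ xm) _; rewrite lee_fin mul0r addr0; exact: l0_le.
- move=> x /andP[x1 x2].
  apply: le_trans (muB _ _) _; first by rewrite ler_norml; lra.
  rewrite lee_fin; have := ll x  => H; apply: le_trans (H _) _; lra.
rewrite -!EFinD lee_fin le_eqVlt; apply/orP; left; apply/eqP.
by field.
Qed.

End Chords.
End UpperBound.

(** * Extremal bodies *)

Section Extremal.
Context {R : realType}.
Implicit Types (B : set (R * R)).

Definition lattice_free B (c1 c2 : R) :=
  forall z1 z2 : int, ~ int2 B (z1%:~R - c1) (z2%:~R - c2).

(** For d = 0 the estimate is 2 m la + k m (1 - m). Since m <= 1 it does not decrease in [k], so [k]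
    may be raised to la/(m - 1/2), and then [la] to 1. *)
Lemma upper_bound B (m s c1 c2 : R) : sym_body B -> bounded2 B -> 1 / 2 < m -> B (m, s) ->
  (forall x y, B (x, y) -> `|x| <= m) -> lattice_free B c1 c2 ->
  m <= 1 -> (area B <= (2 * m ^+ 2 / (2 * m - 1))%:E)%E.
Proof.
move=> bB bdB mg Bp Bm free m1.
have [la [k [l0 [[k0 la1 kla _] _ H]]]] := upper_bound_param bB bdB mg Bp Bm free.
have h0 : 0 <= (0 : R) <= m by rewrite lexx; lra.
apply: le_trans (H 0 h0) _; rewrite lee_fin ler_pdivlMr; last lra.
have h1 : (k * (m - 1 / 2)) * (m * (1 - m)) <= la * (m * (1 - m)).
  by apply: ler_wpM2r => //; apply: mulr_ge0; lra.
have h2 : la * m ^+ 2 <= 1 * m ^+ 2 by apply: ler_wpM2r => //; exact: sqr_ge0.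
have -> : 2 * (0 * l0 + (m - 0) * (la + k / 2 - k * (0 + m) / 2)) * (2 * m - 1) =
   2 * (k * (m - 1 / 2) * (m * (1 - m))) + 2 * m * la * (2 * m - 1) by field.
have -> : 2 * m ^+ 2 = 2 * (1 * m ^+ 2) by ring.
apply: le_trans (_ : 2 * (la * m ^+ 2) <= _); last by lra.
have -> : 2 * (la * m ^+ 2) = 2 * (la * (m * (1 - m))) + 2 * m * la * (2 * m - 1) by ring.
by lra.
Qed.

(** For m > 1 the term k m (1 - m) is at most 0, so the area is at most 2m, which is less than
    2m^2. *)
Lemma half_width_le1 B (m s c1 c2 : R) : sym_body B -> bounded2 B -> 1 / 2 < m -> B (m, s) ->
  (forall x y, B (x, y) -> `|x| <= m) -> lattice_free B c1 c2 ->
  ((2 * m ^+ 2)%:E <= area B)%E -> m <= 1.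
Proof.
move=> bB bdB mg Bp Bm free lb; rewrite leNgt; apply/negP => m1.
have [la [k [l0 [[k0 la1 kla _] _ H]]]] := upper_bound_param bB bdB mg Bp Bm free.
have h0 : 0 <= (0 : R) <= m by rewrite lexx; lra.
have := le_trans lb (H 0 h0); rewrite lee_fin.
have -> : 2 * (0 * l0 + (m - 0) * (la + k / 2 - k * (0 + m) / 2)) =
   2 * m * la + k * (m * (1 - m)) by field.
have h1 : 0 <= k * (m * (m - 1)) by rewrite !mulr_ge0//; lra.
have h2 : m * la <= m * 1 by apply: ler_wpM2l => //; lra.
have h3 : m * 1 < m * m by rewrite ltr_pM2l; lra.
by rewrite expr2; lra.
Qed.

(** For m < 1 equality forces la = 1, k = 1/(m - 1/2) and a chord at 0 reaching the line's value
    2m/(2m - 1). Then (m, s) and (0, m/(2m - 1)) span a parallelogram that already has the full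
    area. *)
Lemma upper_bound_eq B (m s c1 c2 : R) : sym_body B -> bounded2 B -> 1 / 2 < m -> B (m, s) ->
  (forall x y, B (x, y) -> `|x| <= m) -> lattice_free B c1 c2 ->
  m < 1 -> area B = (2 * m ^+ 2 / (2 * m - 1))%:E ->
  B = pgram (m, s) (0, m / (2 * m - 1)).
Proof.
move=> bB bdB mg Bp Bm free m1 AB.
have [la [k [l0 [[k0 la1 kla lal0] Bl0 H]]]] := upper_bound_param bB bdB mg Bp Bm free.
have m0 : 0 < m by lra.
have mm : 0 < 2 * m - 1 by lra.
have mmn : 2 * m - 1 != 0 by rewrite gt_eqF.
have mh : m - 1 / 2 != 0 by rewrite gt_eqF//; lra.
have h0 : 0 <= (0 : R) <= m by rewrite lexx; lra.
have := H 0 h0; rewrite AB lee_fin ler_pdivrMr//.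
have -> : 2 * (0 * l0 + (m - 0) * (la + k / 2 - k * (0 + m) / 2)) * (2 * m - 1) =
   2 * (k * (m - 1 / 2) * (m * (1 - m))) + 2 * m * la * (2 * m - 1) by field.
have mm1 : 0 < m * (1 - m) by apply: mulr_gt0; lra.
move=> U.
have h1 : (k * (m - 1 / 2)) * (m * (1 - m)) <= la * (m * (1 - m)) by rewrite ler_pM2r.
have m2 : 0 < m ^+ 2 by exact: exprn_gt0.
have laE : la = 1.
  have : 1 * m ^+ 2 <= la * m ^+ 2.
    have -> : la * m ^+ 2 = la * (m * (1 - m)) + m * la * (2 * m - 1) by ring.
    by lra.
  by rewrite ler_pM2r//; lra.
have kE : k = 1 / (m - 1 / 2).
  have : 1 * (m * (1 - m)) <= (k * (m - 1 / 2)) * (m * (1 - m)).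
    by move: U; rewrite laE; nra.
  rewrite ler_pM2r// => h.
  have kk : k * (m - 1 / 2) = 1 by lra.
  by apply: (mulIf mh); rewrite kk divfK.
have kp : 0 < k by rewrite kE divr_gt0//; lra.
have l0E : 1 + k / 2 <= l0.
  rewrite leNgt; apply/negP => hl.
  (* The abscissa at which the line has fallen to [l0]. Cutting off the line's tip above this level
     saves the area k d^2 > 0. *)
  pose d := (1 + k / 2 - l0) / k.
  have d0 : 0 < d by rewrite divr_gt0//; lra.
  have dm : 0 <= d <= m.
    rewrite (ltW d0)/= ler_pdivrMr//.
    have : k * (1 / 2) <= k * m by rewrite ler_pM2l//; lra.
    by rewrite laE in lal0; lra.
  have := H d dm; rewrite AB lee_fin; apply/negP; rewrite -ltNge.
  have l0d : l0 = 1 + k / 2 - k * d by rewrite /d; field; rewrite gt_eqF.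
  rewrite l0d laE.
  have -> : 2 * (d * (1 + k / 2 - k * d) + (m - d) * (1 + k / 2 - k * (d + m) / 2)) =
     2 * m * (1 + k / 2 - k * m / 2) - k * d ^+ 2 by field.
  have -> : 2 * m * (1 + k / 2 - k * m / 2) = 2 * m ^+ 2 / (2 * m - 1).
    by rewrite kE; field.
  have : 0 < k * d ^+ 2 by rewrite mulr_gt0// exprn_gt0.
  by lra.
have [clB cB sB B00] := bB.
have LE : 1 + k / 2 = 2 * (m / (2 * m - 1)).
  by rewrite kE; field.
have L0 : 0 < m / (2 * m - 1) by rewrite divr_gt0.
apply: pgram_of_area => //.
- apply: (convex_vert cB (sym_body0 bB) Bl0); rewrite (ltW L0)/=.
  by rewrite LE in l0E; lra.
- by rewrite /det2/= mulr0 subr0 mulr_gt0.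
- by rewrite AB /det2/= mulr0 subr0; congr EFin; field.
Qed.

Lemma half_int (c : R) : (forall z : int, 1 / 2 <= `|z%:~R - c|) -> exists i : int, c = i%:~R + 1 / 2.
Proof.
move=> H; have [z zc] := nearest_int c; have := H z => zc'.
have E : `|z%:~R - c| = 1 / 2 by lra.
have [h|h] := leP 0 (z%:~R - c).
  by exists (z - 1); rewrite intrB; move: E; rewrite ger0_norm//; lra.
by exists z; move: E; rewrite ltr0_norm//; lra.
Qed.

(** |a| + |b| is the gauge of the parallelogram, and points of gauge below 1 are interior; the
    centre is treated apart because the proof divides by the gauge. *)
Lemma pgram_free B (p q : R * R) (c1 c2 : R) : sym_body B -> B = pgram p q -> lattice_free B c1 c2 ->
  forall (z1 z2 : int) (a b : R), z1%:~R - c1 = a * p.1 + b * q.1 ->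
    z2%:~R - c2 = a * p.2 + b * q.2 -> 1 <= `|a| + `|b|.
Proof.
move=> bB BE free z1 z2 a b E1 E2; rewrite leNgt; apply/negP => h.
apply: (free z1 z2); rewrite E1 E2.
have [N0|N0] := ltP 0 (`|a| + `|b|); last first.
  have [/eqP a0 /eqP b0] : `|a| = 0 /\ `|b| = 0.
    by have := normr_ge0 a; have := normr_ge0 b; split; lra.
  move: a0 b0; rewrite !normr_eq0 => /eqP -> /eqP ->; rewrite !mul0r addr0.
  by case: bB.
set N := `|a| + `|b| in h N0.
have Nn : N != 0 by rewrite gt_eqF.
apply: (int2_scale (t := N) (x := a / N * p.1 + b / N * q.1)
  (y := a / N * p.2 + b / N * q.2) bB).
- by rewrite gtr0_norm.
- rewrite BE; exists (a / N), (b / N); split => //.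
  by rewrite !normrM !normfV (gtr0_norm N0) -mulrDl divff.
- by field.
- by field.
Qed.

Lemma lattice_pt_affine2 (a b c d e f : int) (x : R * R) : lattice_pt x ->
  lattice_pt (affine2 a%:~R b%:~R c%:~R d%:~R e%:~R f%:~R x).
Proof.
case: x => [x y] [[/= i ->] [/= j ->]]; split => /=.
  by exists (a * i + b * j + e); rewrite !intrD !intrM.
by exists (c * i + d * j + f); rewrite !intrD !intrM.
Qed.

Lemma unimodular_affine2 (a b c d e f : int) : (a * d - b * c) ^+ 2 = 1 ->
  unimodular (@affine2 R a%:~R b%:~R c%:~R d%:~R e%:~R f%:~R).
Proof.
move=> D; split; first by exists a%:~R, b%:~R, c%:~R, d%:~R, e%:~R, f%:~R.
have [dt dtE] : exists dt, dt = a * d - b * c by eexists.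
rewrite -dtE in D.
have Dr' : (dt%:~R : R) = a%:~R * d%:~R - b%:~R * c%:~R by rewrite dtE intrB !intrM.
(* The inverse is the adjugate times the determinant [dt], since dt^2 = 1; so it is integral too. *)
pose G : R * R -> R * R := affine2 (dt * d)%:~R (dt * - b)%:~R (dt * - c)%:~R (dt * a)%:~R
   (dt * (b * f - d * e))%:~R (dt * (c * e - a * f))%:~R.
have FG : cancel (affine2 a%:~R b%:~R c%:~R d%:~R e%:~R f%:~R) G.
  move=> [x y]; rewrite /G /affine2/= !intrM !intrN !intrB !intrM.
  congr (_, _).
    transitivity (x * (dt%:~R * (a%:~R * d%:~R - b%:~R * c%:~R))); first by ring.
    by rewrite -Dr' -expr2 -rmorphXn/= D mulr1.
  transitivity (y * (dt%:~R * (a%:~R * d%:~R - b%:~R * c%:~R))); first by ring.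
  by rewrite -Dr' -expr2 -rmorphXn/= D mulr1.
have GF : cancel G (affine2 a%:~R b%:~R c%:~R d%:~R e%:~R f%:~R).
  move=> [x y]; rewrite /G /affine2/= !intrM !intrN !intrB !intrM.
  congr (_, _).
    transitivity ((x - e%:~R) * (dt%:~R * (a%:~R * d%:~R - b%:~R * c%:~R)) + e%:~R); first by ring.
    by rewrite -Dr' -expr2 -rmorphXn/= D mulr1 subrK.
  transitivity ((y - f%:~R) * (dt%:~R * (a%:~R * d%:~R - b%:~R * c%:~R)) + f%:~R); first by ring.
  by rewrite -Dr' -expr2 -rmorphXn/= D mulr1 subrK.
split; first by exists G.
move=> x; split; first exact: lattice_pt_affine2.
by move=> h; rewrite -(FG x); exact: lattice_pt_affine2.
Qed.

Lemma unimodular_comp (S T : R * R -> R * R) : unimodular S -> unimodular T -> unimodular (S \o T).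
Proof.
move=> [[a [b [c [d [e [f SE]]]]]] [bS lS]] [[a' [b' [c' [d' [e' [f' TE]]]]]] [bT lT]].
split.
  exists (a * a' + b * c'), (a * b' + b * d'), (c * a' + d * c'), (c * b' + d * d'),
    (a * e' + b * f' + e), (c * e' + d * f' + f) => x.
  by rewrite /= SE TE/=; congr (_, _); ring.
split; first exact: bij_comp.
by move=> p; rewrite lT lS.
Qed.

Lemma image_affine2_translate (a b c d e f : R) (v : R * R) B :
  affine2 a b c d e f @` translate2 v B =
  translate2 (affine2 a b c d e f v) (affine2 a b c d 0 0 @` B).
Proof.
apply/seteqP; split => [_ [_ [x Bx <-] <-]|_ [_ [x Bx <-] <-]].
  exists (affine2 a b c d 0 0 x); first by exists x.
  by rewrite /padd /affine2/=; congr (_, _); ring.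
exists (padd v x); first by exists x.
by rewrite /padd /affine2/=; congr (_, _); ring.
Qed.

Lemma image_affine2_pgram (a b c d : R) (p q : R * R) :
  affine2 a b c d 0 0 @` pgram p q = pgram (affine2 a b c d 0 0 p) (affine2 a b c d 0 0 q).
Proof.
apply/seteqP; split => [_ [_ [s [t [st ->]]] <-]|_ [s [t [st ->]]]].
  by exists s, t; split => //; rewrite /affine2/=; congr (_, _); ring.
exists (s * p.1 + t * q.1, s * p.2 + t * q.2); first by exists s, t.
by rewrite /affine2/=; congr (_, _); ring.
Qed.

Lemma pgramC (p q : R * R) : pgram p q = pgram q p.
Proof.
apply/seteqP; split => _ [a [b [ab ->]]]; exists b, a; rewrite addrC; split => //;
by congr (_, _); ring.
Qed.

Lemma covering (al m c1 c2 : R) : 0 <= al < 1 -> Num.max (1 + al) (2 - al) < 2 * m ->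
  exists z1 z2 : int, `|z1%:~R - c1| + `|z2%:~R - c2 - al * (z1%:~R - c1)| < m.
Proof.
move=> /andP[a0 a1]; rewrite gt_max => /andP[m1 m2].
pose z := Num.floor c1.
have := floor_le c1; have := floorD1_gt c1; rewrite -/z intrD => z1 z0.
pose t := c1 - z%:~R.
have t0 : 0 <= t by rewrite /t; lra.
have t1 : t < 1 by rewrite /t; lra.
pose g := c2 - al * t; pose k := Num.floor g.
have := floor_le g; have := floorD1_gt g; rewrite -/k intrD => k1 k0.
have zE : z%:~R - c1 = - t by rewrite /t; ring.
have z1E : (z + 1)%:~R - c1 = 1 - t by rewrite /t intrD; ring.
pose h := g - k%:~R.
have h0 : 0 <= h by rewrite /h; lra.
have h1 : h < 1 by rewrite /h; lra.
have E0 (j : int) : j%:~R - c2 - al * (z%:~R - c1) = j%:~R - k%:~R - h.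
  by rewrite zE /h /g; ring.
have E1 (j : int) : j%:~R - c2 - al * ((z + 1)%:~R - c1) = j%:~R - k%:~R - h - al.
  by rewrite z1E /h /g; ring.
have N0 : `|- t| = t by rewrite normrN ger0_norm.
have N1 : `|1 - t| = 1 - t by rewrite ger0_norm; lra.
(* In each case two lattice points, one in column [z] and one in column [z + 1], have distances
   summing to 2 - al, respectively 1 + al. The sum is below 2m, so one of them is closer than
   [m]. *)
have [ha|ha] := leP (h + al) 1.
  have [c|c] := ltP (t + h) m.
    exists z, k; rewrite E0 zE N0 subrr sub0r normrN ger0_norm//.
  exists (z + 1), (k + 1); rewrite E1 z1E N1 intrD ger0_norm; lra.
have [c|c] := ltP (t + (1 - h)) m.
  exists z, (k + 1); rewrite E0 zE N0 intrD ger0_norm; lra.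
exists (z + 1), (k + 1); rewrite E1 z1E N1 intrD ler0_norm; lra.
Qed.

End Extremal.

(** * Normal forms of the extremal bodies *)

Section BoundedCase.
Context {R : realType}.
Implicit Types (B K : set (R * R)).

Lemma lower_extremal B (m s c1 c2 : R) : sym_body B -> 0 < m -> 0 <= s < m -> B (m, s) ->
  (forall x y, B (x, y) -> `|x| <= m) -> wide B m -> lattice_free B c1 c2 ->
  area B = (2 * m ^+ 2)%:E ->
  exists T (al : R) (v : R * R), [/\ unimodular T, 0 <= al < 1,
    T @` translate2 (c1, c2) B = translate2 v (pgram (m, m * al) (0, m)) &
    forall z1 z2 : int, m <= `|z1%:~R - v.1| + `|z2%:~R - v.2 - al * (z1%:~R - v.1)|].
Proof.
move=> bB m0 sm Bp Bm wB free AB.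
have mn : m != 0 by rewrite gt_eqF.
have frac (r : R) : 0 <= r / m - (Num.floor (r / m))%:~R < 1.
  by have := floor_le (r / m); have := floorD1_gt (r / m); rewrite intrD; lra.
have scaled (x y : R) : 1 <= `|x / m| + `|y / m| -> m <= `|x| + `|y|.
  by rewrite !normrM !normfV (gtr0_norm m0) -mulrDl ler_pdivlMr// mul1r.
have [[r BE]|[r BE]] := lower_bound_eq bB m0 sm Bp Bm wB AB.
  (* Swapping the coordinates turns this family into the other one; subtracting [n] times the new
     first coordinate then brings the slope into [0, 1). *)
  pose n := Num.floor (r / m).
  exists (affine2 0%:~R 1%:~R 1%:~R (- n)%:~R 0%:~R 0%:~R), (r / m - n%:~R),
    (c2, c1 - n%:~R * c2); split.
  - by apply: unimodular_affine2; ring.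
  - exact: frac.
  - rewrite image_affine2_translate BE image_affine2_pgram [in RHS]pgramC !intrN.
    rewrite /affine2/=; congr (translate2 _ (pgram _ _)); congr (_, _); try by ring.
    by field.
  - move=> z1 z2; rewrite /= addrC; apply: scaled.
    apply: (pgram_free bB BE free (z1 := z2 + n * z1) (z2 := z1)) => /=.
      by rewrite intrD intrM; field.
    by field.
pose n := Num.floor (r / m).
exists (affine2 1%:~R 0%:~R (- n)%:~R 1%:~R 0%:~R 0%:~R), (r / m - n%:~R),
  (c1, c2 - n%:~R * c1); split.
- by apply: unimodular_affine2; ring.
- exact: frac.
- rewrite image_affine2_translate BE image_affine2_pgram !intrN.
  rewrite /affine2/=; congr (translate2 _ (pgram _ _)); congr (_, _); try by ring.
  by field.
- move=> z1 z2; rewrite /=; apply: scaled.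
  apply: (pgram_free bB BE free (z1 := z1) (z2 := z2 + n * z1)) => /=.
    by field.
  by rewrite intrD intrM; field.
Qed.

Lemma upper_extremal B (m s c1 c2 : R) : sym_body B -> bounded2 B -> 1 / 2 < m <= 1 ->
  0 <= s < m -> B (m, s) ->
  (forall x y, B (x, y) -> `|x| <= m) -> wide B m -> lattice_free B c1 c2 ->
  area B = (2 * m ^+ 2 / (2 * m - 1))%:E ->
  exists2 T, unimodular T & T @` translate2 (c1, c2) B =
    translate2 (1 / 2, 1 / 2) (pgram (m, 0) (0, m / (2 * m - 1))).
Proof.
move=> bB bdB /andP[mg m1] sm Bp Bm wB free AB.
have m0 : 0 < m by lra.
have mn : m != 0 by rewrite gt_eqF.
(* At m = 1 both area bounds equal 2, so the equality case of the lower bound gives the shape;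
   lattice-freeness then yields al = 0 and a half-integral centre. *)
have := m1; rewrite le_eqVlt => /predU1P[mE|m_lt1].
  have AB2 : area B = (2 * m ^+ 2)%:E by rewrite AB mE; congr EFin; field.
  have [T [al [v [uT al01 TE fT]]]] := lower_extremal bB m0 sm Bp Bm wB free AB2.
  have al0 : al = 0.
    case: (ltP (Num.max (1 + al) (2 - al)) (2 * m)) => [h|].
      have [z1 [z2]] := covering v.1 v.2 al01 h.
      by rewrite ltNge fT.
    by rewrite le_max mE => /orP[]; lra.
  rewrite al0 in TE fT.
  have [i iE] : exists i : int, v.1 = i%:~R + 1 / 2.
    apply: half_int => z; have [z2 z2v] := nearest_int v.2.
    by have := fT z z2; rewrite mul0r subr0 mE; lra.
  have [j jE] : exists j : int, v.2 = j%:~R + 1 / 2.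
    apply: half_int => z; have [z1 z1v] := nearest_int v.1.
    by have := fT z1 z; rewrite mul0r subr0 mE; lra.
  exists (affine2 1%:~R 0%:~R 0%:~R 1%:~R (- i)%:~R (- j)%:~R \o T).
    by apply: unimodular_comp => //; apply: unimodular_affine2; ring.
  rewrite -image_comp TE image_affine2_translate image_affine2_pgram !intrN mE.
  rewrite /affine2/= iE jE; congr (translate2 _ (pgram _ _)); congr (_, _); try by ring.
  by field.
have BE := upper_bound_eq bB bdB mg Bp Bm free m_lt1 AB.
have mm : 0 < 2 * m - 1 by lra.
have mmn : 2 * m - 1 != 0 by rewrite gt_eqF.
set L := m / (2 * m - 1) in BE *.
have L0 : 0 < L by rewrite divr_gt0.
have Ln : L != 0 by rewrite gt_eqF.
have freeE (z1 z2 : int) :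
    1 <= `|z1%:~R - c1| / m + `|z2%:~R - c2 - s / m * (z1%:~R - c1)| / L.
  have := pgram_free bB BE free (z1 := z1) (z2 := z2) (a := (z1%:~R - c1) / m)
    (b := (z2%:~R - c2 - s / m * (z1%:~R - c1)) / L).
  rewrite !normrM !normfV (gtr0_norm m0) (gtr0_norm L0) /=; apply.
    by field; rewrite mn Ln.
  by field; rewrite mn Ln.
(* At offset 1/2 the half-chord is L(1 - 1/(2m)) = 1/2, so the chord has length exactly 1 and every
   integer is at least 1/2 away from its midpoint. *)
have col (z1 : int) (t : R) : z1%:~R - c1 = t -> `|t| = 1 / 2 -> forall z2 : int,
    1 / 2 <= `|z2%:~R - (c2 + s / m * t)|.
  move=> tE th z2; have := freeE z1 z2; rewrite tE th.
  have -> : z2%:~R - c2 - s / m * t = z2%:~R - (c2 + s / m * t) by ring.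
  move=> h; have : 1 - 1 / 2 / m <= `|z2%:~R - (c2 + s / m * t)| / L by lra.
  rewrite ler_pdivlMr//.
  by have -> : (1 - 1 / 2 / m) * L = 1 / 2 by rewrite /L; field; rewrite mn mmn.
(* A column at offset |t| < 1/2 would have a chord of length 2(m - |t|)/(2m - 1) > 1 and hence an
   interior lattice point. *)
have [i iE] : exists i : int, c1 = i%:~R + 1 / 2.
  apply: half_int => z1; rewrite leNgt; apply/negP => h.
  set t := z1%:~R - c1 in h.
  have tm : `|t| / m < 1 by rewrite ltr_pdivrMr//; lra.
  have lh : 1 < (c2 + s / m * t + L * (1 - `|t| / m)) - (c2 + s / m * t - L * (1 - `|t| / m)).
    have -> : (c2 + s / m * t + L * (1 - `|t| / m)) - (c2 + s / m * t - L * (1 - `|t| / m)) =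
       2 * (m - `|t|) / (2 * m - 1) by rewrite /L; field; rewrite mn mmn.
    by rewrite ltr_pdivlMr//; lra.
  have [z2 /andP[h1 h2]] := int_in_long_interval lh.
  have := freeE z1 z2; rewrite -/t.
  have : `|z2%:~R - c2 - s / m * t| < L * (1 - `|t| / m) by rewrite ltr_norml; lra.
  rewrite -ltr_pdivrMl// mulrC; lra.
have [j1 j1E] : exists j : int, c2 + s / m * (1 / 2) = j%:~R + 1 / 2.
  apply: half_int; apply: (col (i + 1)); first by rewrite iE intrD; field.
  by rewrite ger0_norm; lra.
have [j2 j2E] : exists j : int, c2 + s / m * (- (1 / 2)) = j%:~R + 1 / 2.
  apply: half_int; apply: (col i); first by rewrite iE; ring.
  by rewrite normrN ger0_norm; lra.
(* The midpoints over the two columns beside the centre are half-integral and differ by s/m; so s/m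
   is an integer, and an integral shear makes the axis horizontal. *)
pose n := j1 - j2.
have nE : s = n%:~R * m.
  have : s / m = n%:~R by rewrite /n intrB; lra.
  by move=> <-; rewrite divfK.
have c2E : c2 = j2%:~R + 1 / 2 + n%:~R / 2.
  by move: j2E; rewrite nE mulfK//; lra.
exists (affine2 1%:~R 0%:~R (- n)%:~R 1%:~R (- i)%:~R (n * i - j2)%:~R).
  by apply: unimodular_affine2; ring.
rewrite image_affine2_translate BE image_affine2_pgram.
rewrite [in affine2 _ _ _ _ (- i)%:~R _]/affine2 /= !intrB !intrN !intrM.
rewrite /affine2/=; congr (translate2 _ (pgram _ _)); congr (_, _); try by ring.
- by rewrite iE; ring.
- by rewrite iE c2E; field.
- by rewrite nE; ring.
Qed.

Lemma int2_affine2 (a b c d e f : R) B (x y : R) :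
  int2 B (a * x + b * y + e) (c * x + d * y + f) ->
  int2 (affine2 a b c d e f @^-1` B) x y.
Proof.
move=> [r r0 rB].
pose N := 1 + `|a| + `|b| + `|c| + `|d|.
have [[[a0 b0] c0] d0] := (normr_ge0 a, normr_ge0 b, normr_ge0 c, normr_ge0 d).
have N0 : 0 < N by rewrite /N; lra.
have rN : 0 < r / N by exact: divr_gt0.
have rE : N * (r / N) = r by field; rewrite gt_eqF.
have bnd (g h u v : R) : `|g| + `|h| <= N -> `|u| <= r / N -> `|v| <= r / N ->
    `|g * u + h * v| <= r.
  move=> gh ur vr; apply: le_trans (ler_normD _ _) _; rewrite !normrM -rE.
  apply: le_trans (_ : (`|g| + `|h|) * (r / N) <= _); last first.
    by apply: ler_wpM2r => //; exact: ltW.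
  by rewrite mulrDl lerD// ler_wpM2l.
exists (r / N) => // u v ur vr; rewrite /affine2/=.
have -> : (a * (x + u) + b * (y + v) + e, c * (x + u) + d * (y + v) + f) =
  (a * x + b * y + e + (a * u + b * v), c * x + d * y + f + (c * u + d * v)).
  by congr (_, _); ring.
by apply: rB; apply: bnd => //; rewrite /N; lra.
Qed.

(** Turns images into preimages under the inverse, to which the area and closedness lemmas apply. *)
Lemma image_affine2_SL2 (a b c d : R) B : a * d - b * c = 1 ->
  affine2 a b c d 0 0 @` B = affine2 d (- b) (- c) a 0 0 @^-1` B.
Proof.
move=> D; apply/seteqP; split => [_ [[x y] Bx <-]|[x y] Bx].
  rewrite /affine2/=; move: Bx; congr B; congr (_, _).
    by transitivity ((a * d - b * c) * x); [rewrite D mul1r|ring].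
  by transitivity ((a * d - b * c) * y); [rewrite D mul1r|ring].
exists (affine2 d (- b) (- c) a 0 0 (x, y)) => //; rewrite /affine2/=; congr (_, _).
  by transitivity ((a * d - b * c) * x); [ring|rewrite D mul1r].
by transitivity ((a * d - b * c) * y); [ring|rewrite D mul1r].
Qed.

Lemma int_primitive (u v : int) : (u, v) != (0, 0) ->
  exists g u' v' a b : int, [/\ 0 < g, u = g * u', v = g * v' & a * u' + b * v' = 1].
Proof.
move=> uv; pose g := gcdz u v.
have g0 : g != 0 by rewrite gcdz_eq0; move: uv; rewrite xpair_eqE.
have g_gt0 : 0 < g by rewrite lt_neqAle eq_sym g0.
have [a [b abE]] := Bezoutz u v.
have uE : u = g * (u %/ g)%Z by rewrite mulrC divzK// dvdz_gcdl.
have vE : v = g * (v %/ g)%Z by rewrite mulrC divzK// dvdz_gcdr.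
exists g, (u %/ g)%Z, (v %/ g)%Z, a, b; split => //.
by apply: (mulfI g0); rewrite mulr1 -[RHS]abE [in RHS]uE [in RHS]vE; ring.
Qed.

End BoundedCase.

(** * Lattice width *)

Section Widths.
Context {R : realType}.
Implicit Types (B K : set (R * R)).

Lemma width_ge K (u x y : R * R) : K x -> K y ->
  ((dot u x - dot u y)%:E <= width_fun K u)%E.
Proof.
move=> Kx Ky; rewrite EFinB; apply: leeB.
  by apply: ereal_sup_ubound; exists x.
by apply: ereal_inf_lbound; exists y.
Qed.

Lemma width_le K (u : R * R) (lo hi : R) : (forall x, K x -> lo <= dot u x <= hi) ->
  (width_fun K u <= (hi - lo)%:E)%E.
Proof.
move=> H; rewrite EFinB; apply: leeB.
  by apply: ge_ereal_sup => _ [x Kx <-]; rewrite lee_fin; have /andP[] := H _ Kx.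
by apply: le_ereal_inf_tmp => _ [x Kx <-]; rewrite lee_fin; have /andP[] := H _ Kx.
Qed.

Lemma lattice_widthP K (w : \bar R) (u0 : R * R) : lattice_pt u0 -> u0 != (0, 0) ->
  (width_fun K u0 <= w)%E ->
  (forall u, lattice_pt u -> u != (0, 0) -> (w <= width_fun K u)%E) ->
  lattice_width K = w.
Proof.
move=> lu0 u00 uw H; apply/eqP; rewrite eq_le; apply/andP; split.
  by apply: ge_ereal_inf; exists (width_fun K u0) => //; exists u0.
by apply: le_ereal_inf_tmp => _ [u [lu un0] <-]; exact: H.
Qed.

Lemma area_translate2 B (c1 c2 : R) : closed B -> area (translate2 (c1, c2) B) = area B.
Proof.
move=> clB; rewrite -[RHS](@area_affine _ 1 0 0 1 (- c1) (- c2)) //; last by ring.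
congr area; apply/seteqP; split => [_ [x Bx <-]|x Bx].
  move: Bx; rewrite /affine2 /padd/=; congr B.
  by rewrite [LHS]surjective_pairing; congr (_, _); ring.
exists (affine2 1 0 0 1 (- c1) (- c2) x) => //; rewrite /affine2 /padd/=.
by rewrite [RHS]surjective_pairing; congr (_, _); ring.
Qed.

(** B contains a square of half-side [e], so its support function at (u, v) is at least e(|u| +
    |v|). Only finitely many lattice vectors can therefore do better than (1, 0), and the minimum is
    attained. *)
Lemma min_direction B : sym_body B -> bounded2 B -> exists (m : R) (u v : int),
  [/\ 0 < m, (u, v) != (0, 0), wide B m & forall x y, B (x, y) -> u%:~R * x + v%:~R * y <= m].
Proof.
move=> bB bdB; have [clB cB sB [e e0 eB]] := bB.
have Bn0 : B !=set0 by exists (0, 0); exact: sym_body0.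
have /choice[h hP] : forall uv : int * int, exists M : R,
    (exists x y, B (x, y) /\ uv.1%:~R * x + uv.2%:~R * y = M) /\
    (forall x y, B (x, y) -> uv.1%:~R * x + uv.2%:~R * y <= M).
  move=> [u v]; have [x [y [Bxy H]]] := linear_max u%:~R v%:~R clB bdB Bn0.
  by exists (u%:~R * x + v%:~R * y); split => //; exists x, y.
have h_ge (u v : int) : e * (`|u|%:~R + `|v|%:~R) <= h (u, v).
  have [su su1 suE] := norm_signed (u%:~R : R).
  have [sv sv1 svE] := norm_signed (v%:~R : R).
  have ssq (s : R) : `|s| = 1 -> s * s = 1 by move=> s1; rewrite -expr2 -(real_normK (num_real s)) s1 expr1n.
  have : B (su * e, sv * e).
    have := eB (su * e) (sv * e); rewrite !add0r; apply.
      by rewrite normrM su1 mul1r gtr0_norm.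
    by rewrite normrM sv1 mul1r gtr0_norm.
  move=> /((hP (u, v)).2) /=; rewrite -{1}suE -{1}svE !intr_norm.
  congr (_ <= _).
  transitivity (e * ((su * su) * `|u%:~R| + (sv * sv) * `|v%:~R|)); first by ring.
  by rewrite !ssq// !mul1r.
have [N hN] : exists N : nat, h (1, 0) < e * N%:R.
  exists (Num.truncn (h (1, 0) / e)).+1.
  by rewrite -ltr_pdivrMl// mulrC truncnS_gt.
(* Enumerates the integer points of the box [-N, N]^2 by a finite type. *)
pose f (i : 'I_(N + N).+1 * 'I_(N + N).+1) : int * int := (i.1%:Z - N%:Z, i.2%:Z - N%:Z).
have f_surj (u v : int) : `|u| <= N%:Z -> `|v| <= N%:Z -> exists i, f i = (u, v).
  move=> uN vN.
  have dec (w : int) : `|w| <= N%:Z -> exists i : 'I_(N + N).+1, i%:Z - N%:Z = w.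
    move=> wN; have w0 : 0 <= w + N%:Z by lia.
    have wlt : (absz (w + N%:Z)%R < (N + N).+1)%N by lia.
    by exists (Ordinal wlt) => /=; lia.
  by have [i iE] := dec _ uN; have [j jE] := dec _ vN; exists (i, j); rewrite /f/= iE jE.
have N0 : (0 < N)%N.
  rewrite lt0n; apply: contraTneq hN => ->; rewrite mulr0 -leNgt.
  by apply: le_trans (h_ge 1 0); rewrite mulr_ge0 ?(ltW e0)// addr_ge0.
have [i0 i0E] : exists i, f i = (1, 0) by apply: f_surj; lia.
have Pi0 : f i0 != (0, 0) by rewrite i0E.
have [i fi0 imin] := arg_minP (P := fun i => f i != (0, 0)) (fun i => h (f i)) Pi0.
case fE : (f i) fi0 imin => [u v] uv0 imin.
have hmin (u' v' : int) : (u', v') != (0, 0) -> h (u, v) <= h (u', v').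
  move=> uv'; have [hh|hh] := leP (h (1, 0)) (h (u', v')).
    by apply: le_trans hh; have := imin i0 Pi0; rewrite i0E.
  have hlt : `|u'|%:~R + `|v'|%:~R < N%:R :> R.
    by rewrite -(ltr_pM2l e0); apply: le_lt_trans (h_ge _ _) _; exact: lt_trans hN.
  have uvN : `|u'| + `|v'| < N%:Z by rewrite -(ltr_int R) intrD.
  have [j jE] : exists j, f j = (u', v') by apply: f_surj; lia.
  by have := imin j; rewrite jE; exact.
exists (h (u, v)), u, v; split => //; last by move=> x y /((hP (u, v)).2).
- apply: lt_le_trans (h_ge u v); rewrite mulr_gt0//.
  rewrite -intrD ltr0z; move: uv0; rewrite xpair_eqE; lia.
- move=> u' v' /hmin; have [[x [y [Bxy <-]]] _] := hP (u', v').
  by exists x, y.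
Qed.

End Widths.

(** * Normalization and the bounded case *)

Section Bounded.
Context {R : realType}.
Implicit Types (B K : set (R * R)).

Definition normalized B (m s : R) := [/\ sym_body B, bounded2 B, 0 <= s < m, B (m, s) &
  (forall x y, B (x, y) -> `|x| <= m) /\ wide B m].

Lemma sym_body_SL2 B (a b c d : R) : a * d - b * c = 1 -> sym_body B ->
  sym_body (affine2 a b c d 0 0 @` B).
Proof.
move=> D [clB cB sB B0]; rewrite image_affine2_SL2//; split.
- exact: closed_affine2.
- exact: convex_affine2.
- exact: sym0_affine2.
- by apply: int2_affine2; rewrite !mulr0 !addr0.
Qed.

Lemma bounded2_affine2 B (a b c d : R) : bounded2 B -> bounded2 (affine2 a b c d 0 0 @` B).
Proof.
move=> [M BM].
have bnd (g h x y : R) : `|x| <= M -> `|y| <= M -> `|g * x + h * y + 0| <= (`|g| + `|h|) * M.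
  move=> xM yM; rewrite addr0; apply: le_trans (ler_normD _ _) _.
  by rewrite !normrM mulrDl lerD// ler_wpM2l.
exists ((`|a| + `|b|) * M + (`|c| + `|d|) * M) => _ [[x y] Bxy <-] /=.
have [/= xM yM] := BM _ Bxy; have M0 : 0 <= M by apply: le_trans xM.
have h1 := bnd a b _ _ xM yM; have h2 := bnd c d _ _ xM yM.
have h3 : 0 <= (`|a| + `|b|) * M by rewrite mulr_ge0// addr_ge0.
have h4 : 0 <= (`|c| + `|d|) * M by rewrite mulr_ge0// addr_ge0.
by split; lra.
Qed.

Lemma wide_SL2 B (m : R) (a b c d : int) : a * d - b * c = 1 -> wide B m ->
  wide (affine2 a%:~R b%:~R c%:~R d%:~R 0 0 @` B) m.
Proof.
move=> D wB u v uv.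
have [|x [y [Bxy h]]] := wB (u * a + v * c) (u * b + v * d).
  apply: contra_neq uv => -[E1 E2].
  congr (_, _).
    transitivity (u * (a * d - b * c)); first by rewrite D mulr1.
    transitivity ((u * a + v * c) * d - (u * b + v * d) * c); first by ring.
    by rewrite E1 E2 !mul0r subrr.
  transitivity (v * (a * d - b * c)); first by rewrite D mulr1.
  transitivity ((u * b + v * d) * a - (u * a + v * c) * b); first by ring.
  by rewrite E1 E2 !mul0r subrr.
exists (a%:~R * x + b%:~R * y + 0), (c%:~R * x + d%:~R * y + 0); split.
  by exists (x, y).
by apply: le_trans h _; rewrite le_eqVlt; apply/orP; left; apply/eqP; rewrite !intrD !intrM; ring.
Qed.

(** A primitive minimal direction is completed by Bezout to an integral matrix of determinant 1 that
    makes it the first coordinate. *)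
Lemma normalize B : sym_body B -> bounded2 B -> exists (a b c d : int) (m s : R),
  [/\ a * d - b * c = 1, 0 < m, wide B m,
   (forall x y, B (x, y) -> a%:~R * x + b%:~R * y <= m) &
   normalized (affine2 a%:~R b%:~R c%:~R d%:~R 0 0 @` B) m s].
Proof.
move=> bB bdB; have [m [u0 [v0 [m0 uv0 wB le_m]]]] := min_direction bB bdB.
have [g [u [v [a [b [g0 uE vE ab]]]]]] := int_primitive uv0.
(* Dividing the minimal vector by its gcd [g >= 1] cannot increase the support function, so the
   primitive vector is minimal as well. *)
have le_m' x y : B (x, y) -> u%:~R * x + v%:~R * y <= m.
  move=> /le_m; rewrite uE vE !intrM -!mulrA -mulrDr => h.
  have [h0|h0] := leP 0 (u%:~R * x + v%:~R * y); last by lra.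
  apply: le_trans h; rewrite -[leLHS]mul1r ler_wpM2r//.
  by rewrite (_ : 1 = 1%:~R)// ler_int; lia.
have uv1 : (u, v) != (0, 0).
  by apply: contra_eq_neq ab => -[-> ->]; rewrite !mulr0 addr0.
have [x [y [Bxy xym]]] := wB u v uv1.
have xyE : u%:~R * x + v%:~R * y = m by apply/eqP; rewrite eq_le xym le_m'.
(* The second row may be changed by multiples of the first; subtracting [n] times it reduces the
   second coordinate modulo [m]. *)
pose s0 := - b%:~R * x + a%:~R * y; pose n := Num.floor (s0 / m).
have D : u * (a - n * v) - v * (- b - n * u) = 1 by rewrite -ab; ring.
exists u, v, (- b - n * u), (a - n * v), m, (s0 - n%:~R * m); split => //.
have [_ _ sB _] := bB.
split.
- by apply: sym_body_SL2 => //; rewrite -!intrM -intrB D.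
- exact: bounded2_affine2.
- have := floor_le (s0 / m); have := floorD1_gt (s0 / m); rewrite -/n intrD.
  by rewrite ltr_pdivrMr// ler_pdivlMr// mulrDl mul1r; lra.
- exists (x, y) => //; rewrite /affine2/= !addr0 xyE; congr (_, _).
  by rewrite -[in RHS]xyE /s0 !intrB intrN !intrM; ring.
- split; last exact: wide_SL2.
  move=> _ _ [[x' y'] Bxy' [<- _]] /=; rewrite addr0 ler_norml le_m'// andbT lerNl.
  by apply: le_trans (le_m' _ _ (sB _ _ Bxy')); rewrite !mulrN opprD.
Qed.

Lemma lattice_free_SL2 B (a b c d : int) (c1 c2 : R) : a * d - b * c = 1 ->
  lattice_free B c1 c2 ->
  lattice_free (affine2 a%:~R b%:~R c%:~R d%:~R 0 0 @` B)
    (a%:~R * c1 + b%:~R * c2) (c%:~R * c1 + d%:~R * c2).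
Proof.
move=> D free z1 z2 H; apply: (free (d * z1 - b * z2) (a * z2 - c * z1)).
have Dr : a%:~R * d%:~R - b%:~R * c%:~R = 1 :> R by rewrite -!intrM -intrB D.
set F := affine2 _ _ _ _ _ _ in H.
have -> : B = F @^-1` (F @` B).
  apply/seteqP; split => [x Bx|[x y] [[x' y'] Bxy]]; first by exists x.
  rewrite /F /affine2/= => -[E1 E2].
  suff [<- <-] : x' = x /\ y' = y by [].
  split.
    transitivity ((a%:~R * d%:~R - b%:~R * c%:~R) * x'); first by rewrite Dr mul1r.
    transitivity (d%:~R * (a%:~R * x' + b%:~R * y' + 0) - b%:~R * (c%:~R * x' + d%:~R * y' + 0)); first by ring.
    transitivity ((a%:~R * d%:~R - b%:~R * c%:~R) * x); last by rewrite Dr mul1r.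
    by rewrite E1 E2; ring.
  transitivity ((a%:~R * d%:~R - b%:~R * c%:~R) * y'); first by rewrite Dr mul1r.
  transitivity (a%:~R * (c%:~R * x' + d%:~R * y' + 0) - c%:~R * (a%:~R * x' + b%:~R * y' + 0)); first by ring.
  transitivity ((a%:~R * d%:~R - b%:~R * c%:~R) * y); last by rewrite Dr mul1r.
  by rewrite E1 E2; ring.
apply: int2_affine2; move: H; congr int2; rewrite !intrB !intrM.
  transitivity ((a%:~R * d%:~R - b%:~R * c%:~R) * z1%:~R - (a%:~R * c1 + b%:~R * c2)); last by ring.
  by rewrite Dr mul1r.
transitivity ((a%:~R * d%:~R - b%:~R * c%:~R) * z2%:~R - (c%:~R * c1 + d%:~R * c2)); last by ring.
by rewrite Dr mul1r.
Qed.

Lemma wide_width B (m c1 c2 : R) (u : R * R) : sym_body B -> wide B m ->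
  lattice_pt u -> u != (0, 0) -> ((2 * m)%:E <= width_fun (translate2 (c1, c2) B) u)%E.
Proof.
case: u => [_ _] [_ _ sB _] wB [[/= i ->] [/= j ->]] u0.
have ij : (i, j) != (0, 0) by apply: contra_neq u0 => -[-> ->].
have [x [y [Bxy h]]] := wB i j ij.
apply: le_trans (width_ge (x := padd (c1, c2) (x, y)) (y := padd (c1, c2) (- x, - y)) _ _ _).
- by rewrite lee_fin /dot/=; lra.
- by exists (x, y).
- by exists (- x, - y) => //; exact: sB.
Qed.

Lemma bounded_case B (c1 c2 : R) : sym_body B -> bounded2 B -> lattice_free B c1 c2 ->
  exists m : R, [/\ 0 < m <= 1, lattice_width (translate2 (c1, c2) B) = (2 * m)%:E,
    ((2 * m ^+ 2)%:E <= area B)%E,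
    (1 / 2 < m -> (area B <= (2 * m ^+ 2 / (2 * m - 1))%:E)%E /\
      (area B = (2 * m ^+ 2 / (2 * m - 1))%:E ->
       exists2 T, unimodular T & T @` translate2 (c1, c2) B =
        translate2 (1 / 2, 1 / 2) (pgram (m, 0) (0, m / (2 * m - 1))))) &
    (area B = (2 * m ^+ 2)%:E -> exists T (al : R) (v : R * R), [/\ unimodular T,
      0 <= al < 1, 2 * m <= Num.max (1 + al) (2 - al) &
      T @` translate2 (c1, c2) B = translate2 v (pgram (m, m * al) (0, m))])].
Proof.
move=> bB bdB free; have [clB cB sB B0] := bB.
have [a [b [c [d [m [s [D m0 wB le_m]]]]]]] := normalize bB bdB.
have free1 := lattice_free_SL2 D free.
have Dr : a%:~R * d%:~R - b%:~R * c%:~R = 1 :> R by rewrite -!intrM -intrB D.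
have A1 : area (affine2 a%:~R b%:~R c%:~R d%:~R 0 0 @` B) = area B.
  rewrite image_affine2_SL2// area_affine//.
  transitivity ((a%:~R * d%:~R - b%:~R * c%:~R : R) ^+ 2); first by ring.
  by rewrite Dr expr1n.
set F := affine2 _ _ _ _ _ _ in A1 free1 *.
move=> [bB1 bdB1 sm Bp [Bm wB1]].
have FT : F @` translate2 (c1, c2) B = translate2 (a%:~R * c1 + b%:~R * c2, c%:~R * c1 + d%:~R * c2) (F @` B).
  by rewrite image_affine2_translate; congr translate2; rewrite /affine2/= !addr0.
have uF : unimodular F.
  by rewrite /F -[0]/(0%:~R); apply: unimodular_affine2; rewrite D.
have lb := lower_bound bB1 m0 sm Bp Bm wB1.
have m1 : m <= 1.
  have [mh|mh] := ltP (1 / 2) m; last by lra.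
  exact: half_width_le1 bB1 bdB1 mh Bp Bm free1 lb.
exists m; rewrite m0 m1; split => //.
- apply: (@lattice_widthP _ _ _ (a%:~R, b%:~R)).
  + by split; eexists.
  + apply/eqP => -[/eqP]; rewrite intr_eq0 => /eqP a0 /eqP; rewrite intr_eq0 => /eqP b0.
    by move: D; rewrite a0 b0 !mul0r subrr => /eqP; rewrite eq_sym oner_eq0.
  + pose t := a%:~R * c1 + b%:~R * c2.
    have -> : 2 * m = (t + m) - (t - m) by ring.
    apply: width_le => _ [[x y] Bxy <-]; rewrite /dot /padd /= /t.
    have := le_m _ _ Bxy; have := le_m _ _ (sB _ _ Bxy).
    by rewrite !mulrN; lra.
  + by move=> u lu u0; exact: wide_width.
- by rewrite -A1.
- move=> mh; rewrite -A1; split; first exact: upper_bound bB1 bdB1 mh Bp Bm free1 m1.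
  move=> AE; have mh1 : 1 / 2 < m <= 1 by rewrite mh.
  have [T uT TE] := upper_extremal bB1 bdB1 mh1 sm Bp Bm wB1 free1 AE.
  exists (T \o F); first exact: unimodular_comp.
  by rewrite -image_comp FT.
- rewrite -A1 => AE.
  have [T [al [v [uT al01 TE fT]]]] := lower_extremal bB1 m0 sm Bp Bm wB1 free1 AE.
  exists (T \o F), al, v; split => //.
  + exact: unimodular_comp.
  + rewrite leNgt; apply/negP => /(covering v.1 v.2 al01) [z1 [z2]].
    by rewrite ltNge fT.
  + by rewrite -image_comp FT.
Qed.

End Bounded.

(** * Unbounded bodies *)

Section UnboundedCase.
Context {R : realType}.
Implicit Types (B K : set (R * R)).

(** B contains segments of slope [t n] over [-n, n], with slopes in [-1, 1]. A cluster point of the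
    slopes gives a whole line, as B is closed. *)
Lemma recession_slope B : closed B -> convex_set2 B -> sym0 B ->
  (forall n : nat, exists x y, [/\ B (x, y), `|y| <= `|x| & n%:R < `|x|]) ->
  exists t : R, forall s : R, B (s, s * t).
Proof.
move=> clB cB sB H.
have /choice[xs xsP] : forall n : nat, exists z : R * R,
    [/\ B z, `|z.2| <= `|z.1| & n%:R < `|z.1|].
  by move=> n; have [x [y ?]] := H n; exists (x, y).
pose t n := (xs n).2 / (xs n).1.
have xs0 n : 0 < `|(xs n).1| by case: (xsP n) => _ _; apply: le_lt_trans.
have tB n s : `|s| <= n%:R -> B (s, s * t n).
  case: (xsP n) => Bx _ nx sn; have x0 : (xs n).1 != 0 by rewrite -normr_gt0.
  apply: (pgram_sub cB sB Bx Bx); exists (s / (xs n).1), 0; rewrite normr0 addr0; split.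
    by rewrite normrM normfV ler_pdivrMr// mul1r; apply: le_trans sn (ltW nx).
  by rewrite /t; congr (_, _); field.
have t1 n : `[-1, 1]%classic (t n).
  rewrite /= in_itv/= -ler_norml /t normrM normfV ler_pdivrMr// mul1r.
  by case: (xsP n).
have [|r [_ rcl]] := @segment_compact R (-1) 1 (t @ \oo) _.
  by exists 0%N => // n _; exact: t1.
exists r => s; pose C := affine2 0 0 0 s s 0 @^-1` B.
have clC : closed ((fun y : R => (0 : R, y)) @^-1` C).
  apply: closed_comp; last exact: closed_affine2.
  by move=> y _; apply: (cvg_pair (cvg_cst _) cvg_id).
have CE y : ((fun y : R => (0 : R, y)) @^-1` C) y = B (s, s * y).
  by rewrite /C /affine2/=; congr B; congr (_, _); ring.
rewrite -CE; apply: clC => A nA; apply: rcl => //.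
exists (Num.truncn `|s|).+1 => // n ns.
suff: B (s, s * t n) by rewrite -CE.
apply: tB.
apply: le_trans (ltW (truncnS_gt `|s|)) _.
by rewrite ler_nat.
Qed.

(** An unbounded set is unbounded in one of the cones |y| <= |x| and |x| <= |y|, which the
    coordinate swap exchanges. *)
Lemma recession_line B : sym_body B -> ~ bounded2 B ->
  exists v1 v2 : R, (v1, v2) != (0, 0) /\ forall s : R, B (s * v1, s * v2).
Proof.
move=> [clB cB sB _] ubB.
have [H|H] := pselect (forall n : nat, exists x y, [/\ B (x, y), `|y| <= `|x| & n%:R < `|x|]).
  have [t tB] := recession_slope clB cB sB H.
  exists 1, t; split; first by rewrite xpair_eqE oner_eq0.
  by move=> s; rewrite mulr1.
have [H'|H'] := pselect (forall n : nat, exists x y, [/\ B (x, y), `|x| <= `|y| & n%:R < `|y|]).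
  pose S := affine2 0 1 1 0 0 0 @^-1` B.
  have SE x y : S (x, y) = B (y, x).
    by rewrite /S /affine2/=; congr B; congr (_, _); ring.
  have [t tB] : exists t : R, forall s : R, S (s, s * t).
    apply: recession_slope.
    - exact: closed_affine2.
    - exact: convex_affine2.
    - exact: sym0_affine2.
    - by move=> n; have [x [y [? ? ?]]] := H' n; exists y, x; rewrite SE.
  exists t, 1; split; first by rewrite xpair_eqE oner_eq0 andbF.
  by move=> s; rewrite mulr1 -SE.
exfalso; apply: ubB.
move/existsNP: H => [n1 H]; move/existsNP: H' => [n2 H'].
have n10 : 0 <= n1%:R :> R by [].
have n20 : 0 <= n2%:R :> R by [].
exists (n1%:R + n2%:R) => -[x y] Bxy /=.
have [xy|xy] := leP `|y| `|x|.
  have : `|x| <= n1%:R by rewrite leNgt; apply/negP => h; apply: H; exists x, y.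
  by split; lra.
have : `|y| <= n2%:R by rewrite leNgt; apply/negP => h; apply: H'; exists x, y; rewrite ltW.
by split; lra.
Qed.

(** Pigeonhole: two multiples of v2/v1 have fractional parts in the same of [N] equal subintervals,
    and [N] exceeds |v1|/r. *)
Lemma dirichlet (v1 v2 r : R) : 0 < r ->
  exists k1 k2 : int, (k1, k2) != (0, 0) /\ `|v1 * k2%:~R - v2 * k1%:~R| < r.
Proof.
move=> r0; have [->|v10] := eqVneq v1 0.
  by exists 0, 1; split => //; rewrite mul0r mulr0 subrr normr0.
have nv1 : 0 < `|v1| by rewrite normr_gt0.
pose t := v2 / v1; pose N := (Num.truncn (`|v1| / r)).+1.
have N0 : 0 < N%:R :> R by rewrite ltr0n.
have Nr : `|v1| < r * N%:R by rewrite -ltr_pdivrMl// mulrC truncnS_gt.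
pose fr (i : nat) := t * i%:R - (Num.floor (t * i%:R))%:~R.
have fr01 i : 0 <= fr i < 1.
  by rewrite /fr; have := floor_le (t * i%:R); have := floorD1_gt (t * i%:R); rewrite intrD; lra.
pose f (i : nat) := Num.truncn (N%:R * fr i).
have fi i : (f i)%:R <= N%:R * fr i < (f i).+1%:R.
  by apply: truncn_itv; have /andP[h _] := fr01 i; rewrite mulr_ge0// ltW.
have [i [j [ij fij]]] : exists i j : nat, i != j /\ f i = f j.
  apply: contrapT => H.
  suff : (N.+1 <= N)%N by rewrite ltnn.
  apply: (pigeonhole (f := f)).
    move=> i j _ _ fij; apply/eqP; apply: contrapT => /negP ij; apply: H.
    by exists i, j.
  move=> _ [i _ <-] /=; rewrite -(ltr_nat R).
  have /andP[h1 _] := fi i; apply: le_lt_trans h1 _.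
  have /andP[_ h2] := fr01 i.
  by rewrite -[ltRHS]mulr1 ltr_pM2l.
exists (i%:Z - j%:Z), (Num.floor (t * i%:R) - Num.floor (t * j%:R)); split.
  by rewrite xpair_eqE negb_and subr_eq0 eqz_nat ij.
have -> : v1 * (Num.floor (t * i%:R) - Num.floor (t * j%:R))%:~R - v2 * (i%:Z - j%:Z)%:~R =
   v1 * (fr j - fr i).
  by rewrite /fr !intrB -!pmulrn /t; field.
rewrite normrM.
have h : `|fr j - fr i| < N%:R^-1.
  rewrite -(ltr_pM2l N0) divff ?gt_eqF// -[X in X * _](gtr0_norm N0) -normrM mulrBr.
  have /andP[a1 a2] := fi i; have /andP[b1 b2] := fi j.
  rewrite fij in a1 a2; rewrite -natr1 in a2 b2.
  by rewrite ltr_norml; lra.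
apply: lt_trans (_ : `|v1| * N%:R^-1 < _); first by rewrite ltr_pM2l.
by rewrite ltr_pdivrMr.
Qed.

Lemma unbounded_case B (c1 c2 : R) : sym_body B -> ~ bounded2 B -> lattice_free B c1 c2 ->
  exists w : R, [/\ 0 < w <= 1, lattice_width (translate2 (c1, c2) B) = w%:E,
    area B = +oo%E & exists S, is_split S /\ translate2 (c1, c2) B `<=` S].
Proof.
move=> bB ubB free; have [clB cB sB [e e0 eB]] := bB.
have [v1 [v2 [v0 vB]]] := recession_line bB ubB.
pose phi (x y : R) := v1 * y - v2 * x.
have N0 : 0 < v1 ^+ 2 + v2 ^+ 2.
  rewrite lt_neqAle addr_ge0 ?sqr_ge0// andbT eq_sym paddr_eq0 ?sqr_ge0//.
  by rewrite !sqrf_eq0; move: v0; rewrite xpair_eqE.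
(* The body is a strip along v: being closer to the axis than a point of B is interior. *)
have strip x y z1 z2 : B (x, y) -> `|phi z1 z2| < `|phi x y| -> int2 B z1 z2.
  move=> Bxy h; have pn : phi x y != 0 by rewrite -normr_gt0; apply: le_lt_trans h.
  pose th := phi z1 z2 / phi x y.
  have th1 : `|th| < 1 by rewrite normrM normfV ltr_pdivrMr ?normr_gt0// mul1r.
  pose s := (v1 * (z1 - th * x) + v2 * (z2 - th * y)) / (v1 ^+ 2 + v2 ^+ 2).
  have Nn : v1 ^+ 2 + v2 ^+ 2 != 0 by rewrite gt_eqF.
  have thE : th * phi x y = phi z1 z2 by rewrite divfK.
  have cross : v1 * (z2 - th * y) = v2 * (z1 - th * x).
    by apply/eqP; rewrite -subr_eq0; apply/eqP; move: thE; rewrite /phi; lra.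
  have E1 : z1 = th * x + s * v1.
    have -> : s * v1 = (v1 ^+ 2 * (z1 - th * x) + v2 * (v1 * (z2 - th * y))) / (v1 ^+ 2 + v2 ^+ 2).
      by rewrite /s; ring.
    by rewrite cross; field.
  have E2 : z2 = th * y + s * v2.
    have -> : s * v2 = (v2 ^+ 2 * (z2 - th * y) + v1 * (v2 * (z1 - th * x))) / (v1 ^+ 2 + v2 ^+ 2).
      by rewrite /s; ring.
    by rewrite -cross; field.
  (* A factor strictly between |th| and 1: the slack below 1 - |th/t2| weights a distant point of
     the line, and [t2 < 1] makes the result interior. *)
  pose t2 := (1 + `|th|) / 2.
  have [t20 t21 tht2] : [/\ 0 < t2, t2 < 1 & `|th| < t2].
    by have := normr_ge0 th; rewrite /t2; split; lra.
  have t2n : t2 != 0 by rewrite gt_eqF.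
  have th2 : `|th / t2| < 1 by rewrite normrM normfV (gtr0_norm t20) ltr_pdivrMr// mul1r.
  have d0 : 0 < 1 - `|th / t2| by lra.
  apply: (int2_scale (t := t2) (x := th / t2 * x + s / t2 * v1) (y := th / t2 * y + s / t2 * v2) bB).
  - by rewrite gtr0_norm.
  - have [sg sg1 sgE] := norm_signed (th / t2).
    have Bx := sym0_signed sB sg1 Bxy.
    apply: (convex_ptE (t := `|th / t2|) cB Bx (vB (s / t2 / (1 - `|th / t2|)))).
    + by rewrite normr_ge0 ltW.
    + by rewrite mulrA (mulrC `|_|) sgE; congr (_ + _); field; rewrite t2n gt_eqF.
    + by rewrite mulrA (mulrC `|_|) sgE; congr (_ + _); field; rewrite t2n gt_eqF.
  - by rewrite E1; field.
  - by rewrite E2; field.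
have far x y (z1 z2 : int) : B (x, y) -> `|phi x y| <= `|phi z1%:~R z2%:~R - phi c1 c2|.
  move=> Bxy; rewrite leNgt; apply/negP => h; apply: (free z1 z2).
  apply: (strip _ _ _ _ Bxy); apply: le_lt_trans h.
  by rewrite le_eqVlt; apply/orP; left; apply/eqP; congr `|_|; rewrite /phi; ring.
have [q1 [q2 [Bq q0]]] : exists q1 q2, B (q1, q2) /\ 0 < phi q1 q2.
  pose r := e / (1 + `|v1| + `|v2|).
  have [h1 h2] := (normr_ge0 v1, normr_ge0 v2).
  have r0 : 0 < r by apply: divr_gt0 => //; lra.
  have re (x : R) : `|x| <= 1 + `|v1| + `|v2| -> `|r * x| <= e.
    move=> hx; rewrite normrM (gtr0_norm r0).
    apply: le_trans (ler_wpM2l (ltW r0) hx) _.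
    by rewrite /r divfK// gt_eqF//; lra.
  exists (r * - v2), (r * v1); split.
    have := eB (r * - v2) (r * v1); rewrite !add0r; apply; apply: re; rewrite ?normrN; lra.
  rewrite /phi (_ : _ - _ = r * (v1 ^+ 2 + v2 ^+ 2)); last by ring.
  exact: mulr_gt0.
have [k1 [k2 [k0 kq]]] := dirichlet v1 v2 q0.
(* Were the value nonzero, some multiple of (k1, k2) would have [phi] within half of it from
   [phi c1 c2]. That is less than [phi q1 q2], contradicting [far]; so the line is rational. *)
have phik : phi k1%:~R k2%:~R = 0.
  apply/eqP; apply: contraT => pk.
  have [j jE] := nearest_int (phi c1 c2 / phi k1%:~R k2%:~R).
  have := far _ _ (j * k1) (j * k2) Bq; rewrite (gtr0_norm q0).
  have -> : phi (j * k1)%:~R (j * k2)%:~R - phi c1 c2 =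
     phi k1%:~R k2%:~R * (j%:~R - phi c1 c2 / phi k1%:~R k2%:~R).
    by rewrite mulrBr [in X in _ = _ - X]mulrC divfK// /phi !intrM; ring.
  rewrite normrM => h.
  have : `|phi k1%:~R k2%:~R| * `|j%:~R - phi c1 c2 / phi k1%:~R k2%:~R| <=
     `|phi k1%:~R k2%:~R| * (1 / 2) by rewrite ler_wpM2l.
  by have := kq; rewrite -/(phi _ _); have := normr_ge0 (phi k1%:~R k2%:~R); lra.
have [g [l1 [l2 [a [b [g0 l1E l2E ab]]]]]] := int_primitive k0.
have abr : a%:~R * l1%:~R + b%:~R * l2%:~R = 1 :> R by rewrite -!intrM -intrD ab.
have vl : v1 * l2%:~R = v2 * l1%:~R.
  have gn : g%:~R != 0 :> R by rewrite intr_eq0 gt_eqF.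
  apply: (mulfI gn); apply/eqP; rewrite -subr_eq0; apply/eqP.
  by rewrite -[RHS]phik /phi l1E l2E !intrM; ring.
pose la := a%:~R * v1 + b%:~R * v2.
have v1E : v1 = la * l1%:~R.
  transitivity ((a%:~R * l1%:~R + b%:~R * l2%:~R) * v1); first by rewrite abr mul1r.
  transitivity (a%:~R * l1%:~R * v1 + b%:~R * (v1 * l2%:~R)); first by ring.
  by rewrite vl /la; ring.
have v2E : v2 = la * l2%:~R.
  transitivity ((a%:~R * l1%:~R + b%:~R * l2%:~R) * v2); first by rewrite abr mul1r.
  transitivity (a%:~R * (v2 * l1%:~R) + b%:~R * l2%:~R * v2); first by ring.
  by rewrite -vl /la; ring.
have la0 : la != 0.
  by apply: contra_neq v0 => h; rewrite v1E v2E h !mul0r.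
pose psi (x y : R) := - l2%:~R * x + l1%:~R * y.
have phiE x y : phi x y = la * psi x y by rewrite /phi /psi {1}v1E {1}v2E; ring.
(* The coefficients of [psi] are coprime, so it takes every integer value [j] on the lattice, for
   instance at j(-b, a). Hence K fits between two consecutive integer levels. *)
have pfar x y (j : int) : B (x, y) -> `|psi x y| <= `|j%:~R - psi c1 c2|.
  move=> Bxy; have := far _ _ (j * - b) (j * a) Bxy.
  rewrite !phiE -mulrBr !normrM ler_pM2l ?normr_gt0//.
  have -> // : psi (j * - b)%:~R (j * a)%:~R = j%:~R.
  rewrite /psi !intrM intrN; transitivity (j%:~R * (a%:~R * l1%:~R + b%:~R * l2%:~R) : R); first by ring.
  by rewrite abr mulr1.
have lal : coprimez (- l2) l1.
  by apply/coprimezP; exists (- b, a) => /=; rewrite -ab; ring.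
pose K := translate2 (c1, c2) B; pose u : R * R := ((- l2)%:~R, l1%:~R).
have dotu x y : dot u (padd (c1, c2) (x, y)) = psi c1 c2 + psi x y.
  by rewrite /dot /padd /psi /u/= intrN; ring.
pose j0 := Num.floor (psi c1 c2).
have Kj0 x : K x -> j0%:~R <= dot u x <= j0%:~R + 1.
  move=> [[x1 x2] Bx <-]; rewrite dotu.
  have := pfar _ _ j0 Bx; have := pfar _ _ (j0 + 1) Bx.
  have := floor_le (psi c1 c2); have := floorD1_gt (psi c1 c2); rewrite -/j0 intrD => h1 h2.
  rewrite [X in _ <= X]gtr0_norm; last lra.
  rewrite ler_norml => /andP[h3 h4].
  rewrite [X in _ <= X]ler0_norm; last lra.
  by rewrite ler_norml => /andP[h5 h6]; lra.
have wge u' x y : B (x, y) -> ((2 * dot u' (x, y))%:E <= width_fun K u')%E.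
  move=> Bxy.
  apply: le_trans (width_ge (x := padd (c1, c2) (x, y)) (y := padd (c1, c2) (- x, - y)) _ _ _).
  - by rewrite lee_fin /dot/=; lra.
  - by exists (x, y).
  - by exists (- x, - y) => //; exact: sB.
have wle (h : R) : (forall x y, B (x, y) -> `|psi x y| <= h) -> (width_fun K u <= (2 * h)%:E)%E.
  move=> H; have -> : 2 * h = (psi c1 c2 + h) - (psi c1 c2 - h) by ring.
  apply: width_le => _ [[x y] Bxy <-]; rewrite dotu.
  by have := H _ _ Bxy; rewrite ler_norml; lra.
have dotpsi x y : dot u (x, y) = psi x y by rewrite /dot /u /psi/= intrN.
have B_abs x y : B (x, y) -> exists x' y', B (x', y') /\ `|psi x y| = psi x' y'.
  move=> Bxy; have [h|h] := leP 0 (psi x y); first by exists x, y; rewrite ger0_norm.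
  exists (- x), (- y); rewrite ltr0_norm//; split => //; first exact: sB.
  by rewrite /psi; ring.
have W1 : (width_fun K u <= 1%:E)%E.
  have -> : 1 = (j0%:~R + 1) - j0%:~R :> R by ring.
  exact: width_le.
have [w wE w0] : exists2 w, width_fun K u = w%:E & 0 < w.
  have [x [y [Bxy pE]]] := B_abs _ _ Bq.
  have pos : 0 < psi x y.
    rewrite -pE normr_gt0; apply: contraTneq q0; rewrite phiE => ->; rewrite mulr0 ltxx//.
  have Wpos : (0 < width_fun K u)%E.
    by apply: lt_le_trans (wge u _ _ Bxy); rewrite dotpsi lte_fin; lra.
  have Wfin : width_fun K u \is a fin_num.
    by rewrite ge0_fin_numE ?(ltW Wpos)//; apply: le_lt_trans W1 _; exact: ltry.
  by exists (fine (width_fun K u)); [rewrite fineK|rewrite -lte_fin fineK].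
exists w; split.
- by rewrite w0 -lee_fin -wE.
- have lu : lattice_pt u by split; eexists.
  have un0 : u != (0, 0).
    apply/eqP => -[/eqP]; rewrite intr_eq0 => /eqP a0 /eqP; rewrite intr_eq0 => /eqP b0.
    by move: lal; rewrite a0 b0.
  apply: (lattice_widthP (u0 := u)) => //; first by rewrite wE.
  move=> [_ _] [[/= i ->] [/= j ->]] ij0.
  have [h0|h0] := eqVneq (i * l1 + j * l2) 0; last first.
    have hr : i%:~R * l1%:~R + j%:~R * l2%:~R != 0 :> R by rewrite -!intrM -intrD intr_eq0.
    (* This direction is unbounded along the line; [s] picks the point of the line whose opposite
       pair already shows width [w]. *)
    pose s := w / 2 / (la * (i%:~R * l1%:~R + j%:~R * l2%:~R)).
    apply: le_trans (wge (i%:~R, j%:~R) _ _ (vB s)).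
    rewrite lee_fin le_eqVlt; apply/orP; left; apply/eqP.
    by rewrite /dot/= {1}v1E {1}v2E /s; field; rewrite la0 hr.
  (* A lattice vector orthogonal to the line is the integral multiple [ka] of the primitive normal
     [u], so its width is at least that of [u]. *)
  pose ka := a * j - b * i.
  have iE : i = - (ka * l2).
    transitivity (i * (a * l1 + b * l2)); first by rewrite ab mulr1.
    transitivity (a * (i * l1 + j * l2) - (ka * l2)); first by rewrite /ka; ring.
    by rewrite h0 mulr0 sub0r.
  have jE : j = ka * l1.
    transitivity (j * (a * l1 + b * l2)); first by rewrite ab mulr1.
    transitivity (b * (i * l1 + j * l2) + (ka * l1)); first by rewrite /ka; ring.
    by rewrite h0 mulr0 add0r.
  have ka0 : ka != 0.
    by apply: contra_neq ij0 => h; rewrite iE jE h !mul0r oppr0.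
  have ka1 : 1 <= `|ka%:~R| :> R by rewrite -intr_norm (_ : 1 = 1%:~R)// ler_int; lia.
  have dE x y : dot (i%:~R, j%:~R) (x, y) = ka%:~R * psi x y.
    by rewrite /dot /psi/= {1}iE {1}jE intrN !intrM; ring.
  have key x y : B (x, y) -> ((2 * `|psi x y|)%:E <= width_fun K (i%:~R, j%:~R))%E.
    move=> Bxy; have [sg sg1 sgE] := norm_signed (ka%:~R * psi x y).
    have ssq : sg * sg = 1 by rewrite -expr2 -(real_normK (num_real sg)) sg1 expr1n.
    apply: le_trans (wge (i%:~R, j%:~R) _ _ (sym0_signed sB sg1 Bxy)).
    rewrite lee_fin dE.
    have -> : ka%:~R * psi (sg * x) (sg * y) = `|ka%:~R * psi x y|.
      transitivity (sg * (ka%:~R * psi x y)); first by rewrite /psi; ring.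
      by rewrite -[X in sg * X]sgE mulrA ssq mul1r.
    by rewrite normrM ler_pM2l// ler_peMl.
  have [Woo|Wfin] := eqVneq (width_fun K (i%:~R, j%:~R)) +oo%E; first by rewrite Woo leey.
  have E : width_fun K (i%:~R, j%:~R) = (fine (width_fun K (i%:~R, j%:~R)))%:E.
    rewrite fineK// ge0_fin_numE ?ltey//; apply: le_trans (key _ _ Bq).
    by rewrite lee_fin mulr_ge0.
  set r := fine _ in E; rewrite E.
  have : (width_fun K u <= (2 * (r / 2))%:E)%E.
    apply: wle => x y Bxy; have := key _ _ Bxy; rewrite E lee_fin; lra.
  by rewrite wE !lee_fin; lra.
- apply/eqyP => A A0.
  (* Moving out along the line makes the parallelogram with q as large as desired; this [s] gives it
     area [A]. *)
  pose s := A / (2 * phi q1 q2).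
  have dE : det2 (s * v1, s * v2) (q1, q2) = A / 2.
    rewrite (_ : det2 _ _ = s * phi q1 q2); last by rewrite /det2 /phi/=; ring.
    by rewrite /s; field; rewrite gt_eqF.
  apply: le_trans (det_le_area bB _ (vB s) Bq); rewrite dE.
    by rewrite lee_fin; lra.
  lra.
- exists (@split_set R (- l2) l1 j0); split; first by exists (- l2), l1, j0.
  by move=> x /Kj0.
Qed.

End UnboundedCase.

(** * Unimodular maps and the reduction to a centred body *)

Section Assembly.
Context {R : realType}.
Implicit Types (B K : set (R * R)).

(** Integrality is read off from the images of the origin and the unit vectors; the preimages of
    their translates give an integral inverse matrix, so the determinant divides 1. *)
Lemma unimodularE (T : R * R -> R * R) : unimodular T -> exists a b c d e f : int,
  T = affine2 a%:~R b%:~R c%:~R d%:~R e%:~R f%:~R /\ (a * d - b * c) ^+ 2 = 1.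
Proof.
move=> [[a [b [c [d [e [f TE]]]]]] [[G TG GT] lT]].
have lpt (i j : int) : lattice_pt (i%:~R : R, j%:~R : R) by split; eexists.
have /lT := lpt 0 0; rewrite TE/= !mulr0 !add0r => -[[/= e' eE] [/= f' fE]].
have /lT := lpt 1 0; rewrite TE/= !mulr0 !mulr1 !addr0 => -[[/= a' aE] [/= c' cE]].
have /lT := lpt 0 1; rewrite TE/= !mulr0 !mulr1 !add0r => -[[/= b' bE] [/= d' dE]].
have aE' : a = (a' - e')%:~R by rewrite intrB -aE -eE; ring.
have bE' : b = (b' - e')%:~R by rewrite intrB -bE -eE; ring.
have cE' : c = (c' - f')%:~R by rewrite intrB -cE -fE; ring.
have dE' : d = (d' - f')%:~R by rewrite intrB -dE -fE; ring.
move: aE' bE' cE' dE'; set A := a' - e'; set B := b' - e'; set C := c' - f'; set D := d' - f'.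
move=> aE' bE' cE' dE'.
exists A, B, C, D, e', f'; split.
  by apply/funext => x; rewrite TE aE' bE' cE' dE' eE fE.
have : lattice_pt (G (e + 1, f)).
  by apply/lT; rewrite GT eE fE; split; [exists (e' + 1); rewrite intrD|exists f'].
have : lattice_pt (G (e, f + 1)).
  by apply/lT; rewrite GT eE fE; split; [exists e'|exists (f' + 1); rewrite intrD].
move: (GT (e + 1, f)) (GT (e, f + 1)).
case: (G (e + 1, f)) => [x y]; case: (G (e, f + 1)) => [x' y'].
rewrite !TE/= => -[E1 E2] [E3 E4] [[/= i' iE'] [/= j' jE']] [[/= i iE] [/= j jE]].
have F1 : A * i + B * j = 1.
  by apply: (@intr_inj R); rewrite intrD !intrM -aE' -bE' -iE -jE; lra.
have F2 : C * i + D * j = 0.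
  by apply: (@intr_inj R); rewrite intrD !intrM -cE' -dE' -iE -jE; lra.
have F3 : A * i' + B * j' = 0.
  by apply: (@intr_inj R); rewrite intrD !intrM -aE' -bE' -iE' -jE'; lra.
have F4 : C * i' + D * j' = 1.
  by apply: (@intr_inj R); rewrite intrD !intrM -cE' -dE' -iE' -jE'; lra.
have F : (A * D - B * C) * (i * j' - i' * j) = 1.
  transitivity ((A * i + B * j) * (C * i' + D * j') - (A * i' + B * j') * (C * i + D * j)); first by ring.
  by rewrite F1 F2 F3 F4; ring.
move: F; set X := A * D - B * C => /(congr1 absz); rewrite abszM => /eqP.
rewrite muln_eq1 => /andP[/eqP X1 _].
by have [->|->] : X = 1 \/ X = -1 by lia.
Qed.

Lemma preimage_image_unimodular (T : R * R -> R * R) K : unimodular T -> T @^-1` (T @` K) = K.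
Proof.
move=> [_ [/bij_inj iT _]]; apply/seteqP; split => [x [y Ky /iT <-]//|x Kx].
by exists x.
Qed.

Lemma area_unimodular (T : R * R -> R * R) K : unimodular T -> closed (T @` K) ->
  area (T @` K) = area K.
Proof.
move=> uT clK; rewrite -[in RHS](preimage_image_unimodular K uT).
have [a [b [c [d [e [f [TE D]]]]]]] := unimodularE uT.
rewrite TE in clK *; rewrite area_affine//.
by rewrite -!intrM -intrB -rmorphXn/= D.
Qed.

Lemma closed_translate2 (v : R * R) B : closed B -> closed (translate2 v B).
Proof.
move=> clB; have -> : translate2 v B = affine2 1 0 0 1 (- v.1) (- v.2) @^-1` B.
  apply/seteqP; split => [_ [[x y] Bx <-]|[x y] Bx].
    by move: Bx; rewrite /affine2 /padd/=; congr B; congr (_, _); ring.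
  by eexists; first exact: Bx; rewrite /affine2 /padd/=; congr (_, _); ring.
exact: closed_affine2.
Qed.

Lemma area_of_pgram_image (T : R * R -> R * R) K (v p q : R * R) : unimodular T ->
  0 < det2 p q -> T @` K = translate2 v (pgram p q) -> area K = (2 * det2 p q)%:E.
Proof.
move=> uT D TE; have clp := closed_pgram D.
rewrite -(area_unimodular uT); last by rewrite TE; exact: closed_translate2.
by rewrite TE; case: v TE => *; rewrite area_translate2// area_pgram.
Qed.

(** Along each diagonal of K the functional [u] changes by twice an integer, up to sign. These
    integers are not both 0, because the diagonals span the plane. *)
Lemma crosspolytope_width (T : R * R -> R * R) K (u : R * R) : unimodular T ->
  T @` K = translate2 (1 / 2, 1 / 2) (pgram (1, 0) (0, 1)) ->
  lattice_pt u -> u != (0, 0) -> (2%:E <= width_fun K u)%E.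
Proof.
move=> uT TE [[i iE] [j jE]] u0.
have [a [b [c [d [e [f [TA D]]]]]]] := unimodularE uT.
have pt (s t : R) : `|s| + `|t| <= 1 -> exists2 x, K x & T x = (1 / 2 + s, 1 / 2 + t).
  move=> st; suff : (T @` K) (1 / 2 + s, 1 / 2 + t) by move=> [x Kx xE]; exists x.
  rewrite TE; exists (s, t) => //; exists s, t; split => //=.
  by congr (_, _); ring.
(* Squares absorb the sign of the determinant, known only to be ±1. *)
have wsq x y (k : int) : K x -> K y -> k != 0 ->
    (dot u x - dot u y) ^+ 2 = (2 * k%:~R) ^+ 2 -> (2%:E <= width_fun K u)%E.
  move=> Kx Ky k0 E.
  have kn : 1 <= `|k%:~R| :> R by rewrite -intr_norm (_ : 1 = 1%:~R)// ler_int; lia.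
  have : `|dot u x - dot u y| = `|2 * k%:~R|.
    by apply/eqP; rewrite -(@eqrXn2 _ 2)// !real_normK ?num_real// E.
  rewrite normrM (@ger0_norm _ 2)// => E2.
  have [h|h] := leP 0 (dot u x - dot u y).
    apply: le_trans (width_ge u Kx Ky); rewrite lee_fin.
    by rewrite (ger0_norm h) in E2; lra.
  apply: le_trans (width_ge u Ky Kx); rewrite lee_fin.
  by rewrite (ltr0_norm h) in E2; lra.
have Dr : (a%:~R * d%:~R - b%:~R * c%:~R) ^+ 2 = 1 :> R.
  by rewrite -!intrM -intrB -rmorphXn/= D.
have [xp Kxp xpE] : exists2 x, K x & T x = (1 / 2 + 1, 1 / 2 + 0).
  by apply: pt; rewrite normr1 normr0 addr0.
have [xm Kxm xmE] : exists2 x, K x & T x = (1 / 2 + - 1, 1 / 2 + 0).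
  by apply: pt; rewrite normrN normr1 normr0 addr0.
have [yp Kyp ypE] : exists2 x, K x & T x = (1 / 2 + 0, 1 / 2 + 1).
  by apply: pt; rewrite normr1 normr0 add0r.
have [ym Kym ymE] : exists2 x, K x & T x = (1 / 2 + 0, 1 / 2 + - 1).
  by apply: pt; rewrite normrN normr1 normr0 add0r.
move: xpE xmE ypE ymE; rewrite TA /affine2 => -[X1 X2] [X3 X4] [Y1 Y2] [Y3 Y4].
set dt := a%:~R * d%:~R - b%:~R * c%:~R in Dr.
have [k0|k0] := eqVneq (i * d - j * c) 0; last first.
  apply: (wsq _ _ _ Kxp Kxm k0); rewrite -[LHS]mul1r -[in LHS]Dr -exprMn; congr (_ ^+ 2).
  rewrite /dot iE jE intrB !intrM /dt.
  transitivity ((i%:~R * d%:~R - j%:~R * c%:~R) * ((a%:~R * xp.1 + b%:~R * xp.2 + e%:~R) - (a%:~R * xm.1 + b%:~R * xm.2 + e%:~R)) +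
    (j%:~R * a%:~R - i%:~R * b%:~R) * ((c%:~R * xp.1 + d%:~R * xp.2 + f%:~R) - (c%:~R * xm.1 + d%:~R * xm.2 + f%:~R))); first by ring.
  by rewrite X1 X2 X3 X4; ring.
have [k0'|k0'] := eqVneq (j * a - i * b) 0; last first.
  apply: (wsq _ _ _ Kyp Kym k0'); rewrite -[LHS]mul1r -[in LHS]Dr -exprMn; congr (_ ^+ 2).
  rewrite /dot iE jE intrB !intrM /dt.
  transitivity ((i%:~R * d%:~R - j%:~R * c%:~R) * ((a%:~R * yp.1 + b%:~R * yp.2 + e%:~R) - (a%:~R * ym.1 + b%:~R * ym.2 + e%:~R)) +
    (j%:~R * a%:~R - i%:~R * b%:~R) * ((c%:~R * yp.1 + d%:~R * yp.2 + f%:~R) - (c%:~R * ym.1 + d%:~R * ym.2 + f%:~R))); first by ring.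
  by rewrite Y1 Y2 Y3 Y4; ring.
exfalso; move/eqP: u0; apply.
have dn : a * d - b * c != 0 by apply: contra_eq_neq D => ->; rewrite expr0n.
have i0 : i = 0.
  apply: (mulIf dn); rewrite mul0r.
  transitivity ((i * d - j * c) * a + (j * a - i * b) * c); first by ring.
  by rewrite k0 k0' !mul0r addr0.
have j0 : j = 0.
  apply: (mulIf dn); rewrite mul0r.
  transitivity ((i * d - j * c) * b + (j * a - i * b) * d); first by ring.
  by rewrite k0 k0' !mul0r addr0.
by rewrite [u]surjective_pairing iE jE i0 j0.
Qed.

Lemma dilate2_pgram (t : R) (p q : R * R) :
  dilate2 t (pgram p q) = pgram (pscale t p) (pscale t q).
Proof.
apply/seteqP; split => [_ [_ [a [b [ab ->]]] <-]|_ [a [b [ab ->]]]].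
  by exists a, b; split => //; rewrite /pscale/=; congr (_, _); ring.
exists (a * p.1 + b * q.1, a * p.2 + b * q.2); first by exists a, b.
by rewrite /pscale/=; congr (_, _); ring.
Qed.

Lemma bounded_area B : closed B -> bounded2 B -> (area B < +oo)%E.
Proof.
move=> clB [M BM]; have mB := closed_measurable2 clB.
have [M0|M0] := leP 0 M; last first.
  have -> : B = set0.
    apply/seteqP; split => // x /BM[h _]; have := normr_ge0 x.1; lra.
  by rewrite /area measure0 ltry.
rewrite (@area_slice _ _ (- M) M)//; last by move=> x /BM[]; rewrite ler_norml.
apply: le_lt_trans (slice_area_le_linear (al := 2 * M) (be := 0) mB _ _) (ltry _); first lra.
move=> x _; have -> : 2 * M + 0 * x = M - - M by ring.
apply: xsection_measure_le => //; first lra.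
by move=> z /BM[_]; rewrite ler_norml.
Qed.

Lemma centered_body K : closed K -> convex_set2 K -> interior K !=set0 ->
  centrally_symmetric K -> (forall p : R * R, lattice_pt p -> ~ interior K p) ->
  exists c1 c2 B, [/\ K = translate2 (c1, c2) B, sym_body B & lattice_free B c1 c2].
Proof.
move=> clK cK [[p1 p2] iKp] [[c1 c2] KE] fK.
pose B := affine2 1 0 0 1 c1 c2 @^-1` K.
have BE x y : B (x, y) = K (c1 + x, c2 + y).
  by rewrite /B /affine2/=; congr K; congr (_, _); ring.
have sB : sym0 B.
  move=> x y; rewrite !BE => Kx; rewrite KE; exists (c1 + x, c2 + y) => //.
  by rewrite /padd /pscale/=; congr (_, _); ring.
have cB : convex_set2 B by exact: convex_affine2.
exists c1, c2, B; split.
- apply/seteqP; split => [[x y] Kxy|_ [[x y] Bxy <-]].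
    exists (x - c1, y - c2); first by rewrite BE !subrKC.
    by rewrite /padd/= !subrKC.
  by move: Bxy; rewrite BE.
- split => //; first exact: closed_affine2.
  have iB : int2 B (p1 - c1) (p2 - c2).
    apply: int2_affine2; move/interior_int2: iKp; congr int2; ring.
  (* The centre is the midpoint of an interior point and its reflection, hence interior. *)
  have Bq := sB _ _ (int2_sub iB).
  by apply: (int2_segment (t := 1 / 2) cB Bq iB); [lra|field|field].
- move=> z1 z2 [e e0 eB]; apply: (fK (z1%:~R, z2%:~R)); first by split; eexists.
  apply/interior_int2; exists e => // x y xe ye.
  have := eB x y xe ye; rewrite BE; congr K; congr (_, _); ring.
Qed.

End Assembly.

Theorem theorem4 (R : realType) (K : set (R * R)) :
  closed K -> convex_set2 K -> interior K !=set0 -> centrally_symmetric K ->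
  (forall p : R * R, lattice_pt p -> ~ interior K p) ->
  exists w : R, lattice_width K = w%:E /\
  (0 < w <= 2) /\
  (1 < w -> (area K <= (w ^+ 2 / (2 * (w - 1)))%:E)%E) /\
  (((w ^+ 2) / 2)%:E <= area K)%E /\
  [/\
(* (I) *)
      (w = 2 <-> exists T, unimodular T /\ T @` K =
         translate2 (1/2, 1/2) (conv_hull [:: (1, 0); (-1, 0); (0, 1); (0, -1)])),
      (* (II) *)
      (w <= 1 -> (area K = +oo%E <-> ~ bounded2 K /\ exists S, is_split S /\ K `<=` S)),
      (* (III) *)
      (1 < w -> (area K = (w ^+ 2 / (2 * (w - 1)))%:E <->
         exists T, unimodular T /\ T @` K =
         translate2 (1/2, 1/2) (conv_hull [:: (w / 2, 0); (- (w / 2), 0);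
                                         (0, w / (2 * (w - 1))); (0, - (w / (2 * (w - 1))))])))
    & (* (IV) *)
      (area K = ((w ^+ 2) / 2)%:E <->
         exists T, unimodular T /\ exists (alpha : R) (v : R * R),
           [/\ 0 <= alpha < 1, w <= Num.max (1 + alpha) (2 - alpha) &
               T @` K = translate2 v (dilate2 (w / 2)
                 (conv_hull [:: (1, alpha); (-1, - alpha); (0, 1); (0, -1)]))])].
Proof.
move=> clK cK iK sK fK.
have [c1 [c2 [B [KE bB free]]]] := centered_body clK cK iK sK fK.
have [clB cB sB B0] := bB.
have AK : area K = area B by rewrite KE area_translate2.
have hull (x y : R) : conv_hull [:: (x, 0); (- x, 0); (0, y); (0, - y)] = pgram (x, 0) (0, y).
  by have := conv_hull_pgram (x, 0) (0, y); rewrite /= oppr0.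
have hull4 (w al : R) : dilate2 (w / 2) (conv_hull [:: (1, al); (-1, - al); (0, 1); (0, -1)]) =
    pgram (w / 2, w / 2 * al) (0, w / 2).
  have := conv_hull_pgram (1, al) (0, 1); rewrite /= oppr0 => ->.
  by rewrite dilate2_pgram /pscale/= mulr0 !mulr1.
(* The converse implications are settled before the case distinction, since the bounded and the
   unbounded case share them. *)
have I_rl (w : R) : lattice_width K = w%:E -> 0 < w <= 2 -> (exists T, unimodular T /\ T @` K =
    translate2 (1/2, 1/2) (conv_hull [:: (1, 0); (-1, 0); (0, 1); (0, -1)])) -> w = 2.
  move=> wE /andP[_ w2] [T [uT]]; rewrite hull => TE.
  apply/eqP; rewrite eq_le w2/= -lee_fin -wE; apply: le_ereal_inf_tmp => _ [u [lu u0] <-].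
  exact: crosspolytope_width TE lu u0.
have III_rl (w : R) : 1 < w -> (exists T, unimodular T /\ T @` K =
    translate2 (1/2, 1/2) (conv_hull [:: (w / 2, 0); (- (w / 2), 0);
      (0, w / (2 * (w - 1))); (0, - (w / (2 * (w - 1))))])) ->
    area K = (w ^+ 2 / (2 * (w - 1)))%:E.
  move=> w1 [T [uT]]; rewrite hull => TE.
  have w10 : 0 < w - 1 by lra.
  rewrite (area_of_pgram_image uT _ TE); last first.
    by rewrite /det2/= mulr0 subr0 mulr_gt0// ?divr_gt0// ?mulr_gt0//; lra.
  by rewrite /det2/=; congr EFin; field; rewrite gt_eqF.
have IV_rl (w : R) : 0 < w -> (exists T, unimodular T /\ exists (alpha : R) (v : R * R),
    [/\ 0 <= alpha < 1, w <= Num.max (1 + alpha) (2 - alpha) &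
      T @` K = translate2 v (dilate2 (w / 2)
        (conv_hull [:: (1, alpha); (-1, - alpha); (0, 1); (0, -1)]))]) ->
    area K = ((w ^+ 2) / 2)%:E.
  move=> w0 [T [uT [al [v [_ _]]]]]; rewrite hull4 => TE.
  rewrite (area_of_pgram_image uT _ TE); last first.
    by rewrite /det2/= mulr0 subr0 mulr_gt0// divr_gt0.
  by rewrite /det2/=; congr EFin; field.
have bdK : bounded2 K <-> bounded2 B.
  have shift (S : set (R * R)) (v : R * R) : bounded2 S -> bounded2 (translate2 v S).
    move=> [M SM]; exists (M + `|v.1| + `|v.2|) => _ [x /SM[h1 h2] <-] /=.
    have [h3 h4] := (normr_ge0 v.1, normr_ge0 v.2).
    by split; apply: le_trans (ler_normD _ _) _; lra.
  split; last by rewrite KE; exact: shift.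
  rewrite KE => /(shift _ (- c1, - c2)).
  have -> // : translate2 (- c1, - c2) (translate2 (c1, c2) B) = B.
  apply/seteqP; split => [_ [_ [[x y] Bx <-] <-]|[x y] Bx].
    by rewrite /padd/= !addKr.
  exists (padd (c1, c2) (x, y)); first by exists (x, y).
  by rewrite /padd/= !addKr.
have [bdB|ubB] := pselect (bounded2 B); last first.
  have [w [/andP[w0 w1] wE AB split]] := unbounded_case bB ubB free.
  rewrite -KE in wE split.
  have w2 : 0 < w <= 2 by rewrite w0; lra.
  have nw1 : 1 < w -> False by rewrite ltNge w1.
  have nw2 : w <> 2 by apply/eqP; rewrite lt_eqF//; lra.
  exists w; split => //; split => //; split; first by move/nw1.
  rewrite AK AB; split; first exact: leey.
  split.
  - by split; [move/nw2|exact: I_rl].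
  - by move=> _; split => // _; split => //; rewrite bdK.
  - by move/nw1.
  - by split => // /(IV_rl _ w0); rewrite AK AB.
have [m [/andP[m0 m1] wE lb ub IV]] := bounded_case bB bdB free.
rewrite -KE in wE ub IV.
have w02 : 0 < 2 * m <= 2 by apply/andP; split; lra.
(* For 2m = 1 both sides are 0, by the convention that the inverse of 0 is 0. *)
have ubE : 2 * m ^+ 2 / (2 * m - 1) = (2 * m) ^+ 2 / (2 * (2 * m - 1)).
  by rewrite -[RHS]mulr1; have [->|h] := eqVneq (2 * m - 1) 0; [rewrite !mulr0 invr0 !mulr0 mul0r|field].
have lbE : 2 * m ^+ 2 = (2 * m) ^+ 2 / 2 by field.
have mE : 2 * m / 2 = m by field.
have III_lr : 1 < 2 * m -> area K = ((2 * m) ^+ 2 / (2 * (2 * m - 1)))%:E ->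
    exists T, unimodular T /\ T @` K = translate2 (1 / 2, 1 / 2)
      (pgram (2 * m / 2, 0) (0, 2 * m / (2 * (2 * m - 1)))).
  move=> mh AE; have mh' : 1 / 2 < m by lra.
  have [_] := ub mh'; rewrite -AK AE ubE => /(_ erefl) [T uT TE].
  exists T; split => //; rewrite TE mE; congr (translate2 _ (pgram _ (_, _))).
  by field; rewrite gt_eqF//; lra.
exists (2 * m); split => //; split => //; split.
  by move=> mh; rewrite AK -ubE; apply: (ub _).1; lra.
split; first by rewrite -lbE AK.
split.
- split; last exact: I_rl.
  (* At w = 2 the lower and upper area bounds coincide, so the equality case of the upper bound
     identifies K. *)
  move=> m2; have mE1 : m = 1 by lra.
  have mh : 1 / 2 < m by lra.
  have AE : area K = ((2 * m) ^+ 2 / (2 * (2 * m - 1)))%:E.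
    apply/eqP; rewrite eq_le AK -{1}ubE (ub mh).1/=; apply: le_trans lb.
    by rewrite lee_fin -ubE mE1 (_ : 2 * 1 - 1 = 1 :> R) ?divr1//; ring.
  have [T [uT TE]] := III_lr ltac:(lra) AE.
  exists T; split => //; rewrite hull TE mE mE1; congr (translate2 _ (pgram _ (_, _))).
  by field.
- move=> _; split => [AE|[nb _]]; last by exfalso; apply/nb/bdK.
  by exfalso; have := bounded_area clB bdB; rewrite -AK AE ltxx.
- by move=> mh; split; [rewrite hull; exact: III_lr|exact: III_rl].
- split; last by apply: IV_rl; lra.
  rewrite AK -lbE => /IV[T [al [v [uT al01 mx TE]]]].
  by exists T; split => //; exists al, v; rewrite hull4 mE.
Qed.
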